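(* Let $r\ge2$, $t\ge1$ be integers and $a\in(3/2,2]$. For every $\beta>0$ there exist $\gamma>0$ and $n_0$ such that for all $n\ge n_0$: if $G$ is an $n$-vertex $T_{r+1}^t$-free digraph with $e_a(G)\ge a\,t_r(n)-\gamma n^2$, then $G$ can be turned into a copy of $\mathrm{DT}_r(n)$ on the same vertex set by changing (adding or deleting) at most $\beta n^2$ arcs.
   Context: For a digraph $G$, $f_1(G)$ is the number of unordered pairs $\{u,v\}$ with exactly one of $uv,vu$ an arc, $f_2(G)$ the number with both arcs present, and $e_a(G):=a f_2(G)+f_1(G)$ for real $a\ge1$. $t_r(n)$ is the number of edges of the $r$-partite Turán graph $\mathrm{Tu}_r(n)$ (complete $r$-partite, parts as equal as possible); $\mathrm{DT}_r(n)$ is obtained from $\mathrm{Tu}_r(n)$ by replacing each edge with two opposite arcs. $T_{r+1}^t$ is the blow-up of the transitive tournament $T_{r+1}$ in which each vertex is replaced by an independent set of size $t$ and each arc $ij$ by all arcs from the $i$-th set to the $j$-th set. *)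

(* Defs.v *)
From HB Require Import structures.
From mathcomp Require Import all_boot all_order all_algebra all_fingroup.
From mathcomp Require Import reals.
Set Implicit Arguments. Unset Strict Implicit. Unset Printing Implicit Defensive.
Import Order.TTheory GRing.Theory Num.Theory.

(* A digraph on vertex set 'I_n is a loopless relation G : rel 'I_n;
   (u,v) is an arc iff G u v. *)
Definition loopless n (G : rel 'I_n) : Prop := forall v, ~~ G v v.

Definition f1 n (G : rel 'I_n) : nat :=
  #|[set p : 'I_n * 'I_n | (p.1 < p.2)%N && (G p.1 p.2 != G p.2 p.1)]|.

Definition f2 n (G : rel 'I_n) : nat :=
  #|[set p : 'I_n * 'I_n | [&& (p.1 < p.2)%N, G p.1 p.2 & G p.2 p.1]]|.

Definition e_a (R : realType) (a : R) n (G : rel 'I_n) : R :=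
  (a * (f2 G)%:R + (f1 G)%:R)%R.

(* Turan graph Tu_r(n) on {0..n-1}: vertex i lies in part (i mod r); the parts
   are the residue classes, which have sizes as equal as possible. *)
Definition turan_adj (r n : nat) (u v : 'I_n) : bool := (u %% r != v %% r)%N.

Definition turan_num (r n : nat) : nat :=
  #|[set p : 'I_n * 'I_n | (p.1 < p.2)%N && turan_adj r p.1 p.2]|.

(* DT_r(n): both opposite arcs for each edge of Tu_r(n). A copy of DT_r(n) on the
   vertex set 'I_n is its image under a permutation s of 'I_n. *)
Definition DT_copy (r n : nat) (s : {perm 'I_n}) : rel 'I_n :=
  fun u v => turan_adj r (s u) (s v).

Definition arc_dist n (G H : rel 'I_n) : nat :=
  #|[set p : 'I_n * 'I_n | (p.1 != p.2) && (G p.1 p.2 != H p.1 p.2)]|.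

(* T_{r+1}^t: vertex set 'I_(r+1) * 'I_t, arc from (i,x) to (j,y) iff i < j
   (blow-up of the transitive tournament on 'I_(r+1) with arcs i -> j for i<j). *)
Definition blowup_arc (r t : nat) (x y : 'I_r.+1 * 'I_t) : bool := (x.1 < y.1)%N.

Definition contains_blowup (r t n : nat) (G : rel 'I_n) : Prop :=
  exists phi : 'I_r.+1 * 'I_t -> 'I_n,
    injective phi /\ forall x y, blowup_arc x y -> G (phi x) (phi y).

Definition blowup_free (r t n : nat) (G : rel 'I_n) : Prop :=
  ~ contains_blowup r t G.

(* Main.v *)
Require Import Defs.
From HB Require Import structures.
From mathcomp Require Import all_boot all_order all_algebra all_fingroup.
From mathcomp Require Import reals.
From mathcomp Require Import ring lra zify.
Set Implicit Arguments. Unset Strict Implicit. Unset Printing Implicit Defensive.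
Import Order.TTheory GRing.Theory Num.Theory.
Local Open Scope ring_scope.

(** Give a pair of vertices weight [a] if it is joined in both directions, [1] if it is joined
    in one direction and [0] otherwise, so that the weights sum up to [2 e_a].

    Turan bound. Order the vertices at random and keep [v] if all earlier vertices are
    out-neighbours of [v], or all are in-neighbours; the kept vertices always form a transitive
    tournament. The expected number of kept vertices gives a Caro-Wei type bound: if no
    transitive tournament has more than [r] vertices, the density is at most
    [lam = a (1 - 1/r)], and, as [a > 3/2], it is smaller by a constant if there are moreover
    no [r] vertices pairwise joined in both directions. Sampling transfers this to digraphs
    with few copies of [T_(r+1)], and a blow-up free digraph is such a digraph by Erdos'
    theorem on complete [k]-partite hypergraphs.

    Stability. Hence [G] has many double [r]-cliques, and few vertices of low weighted degree.
    Averaging yields a double clique [k_1, ..., k_r] of vertices of high degree that lies in few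
    copies of [T_(r+1)]. Almost every vertex is then joined in both directions to all [k_j]
    but one, [k_i], to which it is not joined at all; this defines the [i]-th class. Arcs inside
    a class yield copies of [T_(r+1)], so there are few of them, and counting weights shows
    that few arcs between the classes are missing and that the classes are balanced. *)

(** * Random orders and transitive tournaments *)

(** A permutation [s] is read as an order in which [s v] is the position of [v]. *)
Definition first_in (M : nat) (B : {set 'I_M}) (v : 'I_M) : {set 'S_M} :=
  [set s : 'S_M | [forall u in B, (s v <= s u)%N]].

(** Every order has exactly one first element of [B], and composing with the transposition of [u]
    and [v] exchanges the orders in which [u] and [v] come first. So [v] is first with probability
    [1 / #|B|]. *)
Lemma card_first_in (M : nat) (B : {set 'I_M}) (v : 'I_M) :
  v \in B -> (#|first_in B v| * #|B|)%N = M`!.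
Proof.
move=> vB.
have same u : u \in B -> #|first_in B u| = #|first_in B v|.
  move=> uB; rewrite -(card_imset _ (mulgI (tperm u v))).
  apply/eq_card => s; rewrite !inE; apply/imsetP/forall_inP.
    case=> s'; rewrite inE => /forall_inP s'P -> w wB.
    rewrite !permM tpermR; apply: s'P; case: tpermP => // _; exact: uB || exact: vB.
  move=> sP; exists (tperm u v * s)%g; last by rewrite mulgA tperm2 mul1g.
  rewrite inE; apply/forall_inP => w wB; rewrite !permM tpermL; apply: sP.
  by case: tpermP => // _; exact: uB || exact: vB.
have <- : (\sum_(u in B) #|first_in B u| = M`!)%N.
  under eq_bigr do rewrite -sum1_card.
  rewrite (exchange_big_dep predT) //= -card_Sn -sum1_card.
  apply: eq_bigr => s _.
  case: (arg_minnP (fun u => s u : nat) vB) => w wB wmin.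
  rewrite (big_pred1 w) // => u; rewrite inE /=.
  apply/andP/eqP => [[uB /forall_inP/(_ w wB) le1]|->].
    by apply: (@perm_inj _ s); apply/val_inj/eqP; rewrite eqn_leq le1 wmin.
  by split=> //; apply/forall_inP.
by rewrite (eq_bigr _ same) sum_nat_const mulnC.
Qed.

(** The vertex of largest rank is joined to all the others in one uniform direction, so it can be
    put at the front or at the back of the list obtained for the rest. *)
Lemma pairwise_ordering (V : finType) (e : rel V) (rk : V -> nat) (A : {set V}) :
    injective rk ->
    {in A, forall v, {in A, forall u, (rk u < rk v)%N -> e v u} \/
                     {in A, forall u, (rk u < rk v)%N -> e u v}} ->
  exists L, [/\ size L = #|A|, pairwise e L & {subset L <= A}].
Proof.
move=> rk_inj; elim: {A}#|A| {-2}A (erefl #|A|) => [|m IH] A cA Aord.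
  by exists [::].
have /card_gt0P[v0 v0A] : (0 < #|A|)%N by rewrite cA.
case: (@arg_maxnP _ v0 (fun v => v \in A) rk v0A) => v vA vmax.
have cA' : #|A :\ v| = m by apply/eqP; rewrite -eqSS -cA (cardsD1 v A) vA.
have [w /setD1P[_ wA]|L [sL pL LA]] := IH _ cA'.
  by case: (Aord w wA) => H; [left|right] => u /setD1P[_ uA]; exact: H.
have lt_v u : u \in L -> (u \in A) /\ (rk u < rk v)%N.
  move=> /LA/setD1P[ne uA]; split=> //; rewrite ltn_neqAle [X in _ && X]vmax // andbT.
  by rewrite (inj_eq rk_inj).
have sub_v L' : L' =i v :: L -> {subset L' <= A}.
  by move=> E u; rewrite E inE => /predU1P[->//|/lt_v[]].
case: (Aord v vA) => H.
  exists (v :: L); split; [by rewrite /= sL cA cA'| |exact: sub_v].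
  by rewrite pairwise_cons pL andbT; apply/allP => u /lt_v[uA lt]; exact: H.
exists (rcons L v); split; [by rewrite size_rcons sL cA cA'| |].
  by rewrite pairwise_rcons pL andbT; apply/allP => u /lt_v[uA lt]; exact: H.
by apply: sub_v => u; rewrite mem_rcons.
Qed.

Lemma first_inU (M : nat) (B C : {set 'I_M}) (v : 'I_M) :
  first_in (B :|: C) v = first_in B v :&: first_in C v.
Proof.
apply/setP => s; rewrite !inE; apply/forall_inP/andP => [H|[/forall_inP HB /forall_inP HC] u].
  by split; apply/forall_inP => u uX; apply: H; rewrite inE uX ?orbT.
by rewrite inE => /orP[/HB|/HC].
Qed.

Lemma first_in_ratio (R : realFieldType) (M : nat) (B : {set 'I_M}) (v : 'I_M) :
  v \in B -> #|first_in B v|%:R = M`!%:R / #|B|%:R :> R.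
Proof.
move=> vB; rewrite -(card_first_in vB) natrM mulfK // pnatr_eq0 -lt0n.
by apply/card_gt0P; exists v.
Qed.

(** By inclusion-exclusion the right-hand side is the probability that a vertex is kept. The lower
    bound has a denominator linear in the set sizes, which can be summed over the vertices. In terms
    of [b = m + i] and [c = m + o] the numerator of the difference is a sum of nonnegative terms,
    vanishing for [i = o = 0]. *)
Lemma inv_sum_bound (R : realFieldType) (m b c d : R) :
    1 <= m -> m <= b -> m <= c -> b + c = d + m ->
  3 / (m + b + c) <= b^-1 + c^-1 - d^-1.
Proof.
move=> m1 mb mc E; have -> : d = b + c - m by lra.
have [b0 c0 d0 s0] : [/\ 0 < b, 0 < c, 0 < b + c - m & 0 < m + b + c] by split; lra.
rewrite -subr_ge0.
have -> : b^-1 + c^-1 - (b + c - m)^-1 - 3 / (m + b + c) =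
   (((b + c) * (b + c - m) - b * c) * (m + b + c) - 3 * (b * c * (b + c - m)))
     / (b * c * (b + c - m) * (m + b + c)).
  by field; rewrite !lt0r_neq0.
apply: divr_ge0; last by rewrite !mulr_ge0 // ltW.
set i := b - m; set o := c - m.
have -> : b = m + i by rewrite /i; lra.
have -> : c = m + o by rewrite /o; lra.
have i0 : 0 <= i by rewrite /i; lra.
have o0 : 0 <= o by rewrite /o; lra.
have m0 : 0 <= m by lra.
have -> : ((m + i + (m + o)) * (m + i + (m + o) - m) - (m + i) * (m + o))
    * (m + (m + i) + (m + o)) - 3 * ((m + i) * (m + o) * (m + i + (m + o) - m))
  = m ^+ 2 * (i + o) + (i + o) * (i - o) ^+ 2 + 2 * m * ((i - o) ^+ 2 + i * o) by ring.
have io0 : 0 <= i + o by rewrite addr_ge0.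
have sq0 := sqr_ge0 (i - o).
apply: addr_ge0; first by apply: addr_ge0; apply: mulr_ge0; rewrite ?sqr_ge0.
by apply: mulr_ge0; [rewrite mulr_ge0|rewrite addr_ge0 // mulr_ge0].
Qed.

(** The kept vertices of a random order never exceed [k], hence neither does their expected number.
    The bracket is a defect: 3 on a nonedge, 1 on a single arc, 0 on a double edge; its row sums are
    the denominators in [inv_sum_bound]. *)
Lemma pairwise_random_order (R : realFieldType) (k M : nat) (e : rel 'I_M) :
    (forall v, e v v = false) ->
    (forall L, pairwise e L -> (size L <= k)%N) ->
  3 * M%:R ^+ 2 <= k%:R * \sum_u \sum_v ((~~ e u v && ~~ e v u)%:R
                     + (~~ e u v)%:R + (~~ e v u)%:R) :> R.
Proof.
move=> irr bound.
(* [v] comes first in [B v] exactly if all earlier vertices are out-neighbours of [v], and first in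
   [C v] exactly if all are in-neighbours. *)
pose B v := [set u | ~~ e v u]; pose C v := [set u | ~~ e u v].
have vB v : v \in B v by rewrite inE irr.
have vC v : v \in C v by rewrite inE irr.
pose A s := [set v | s \in first_in (B v) v :|: first_in (C v) v].
have leA s : (#|A s| <= k)%N.
  have inj_s : injective (fun v => s v : nat) by move=> u v /val_inj/perm_inj.
  have [|L [<- /bound //]] := @pairwise_ordering _ e (fun v => s v : nat) (A s) inj_s.
  move=> v; rewrite !inE => /orP[]/forall_inP H; [left|right] => u _ lt_uv;
    by apply: contraLR lt_uv => ne; rewrite -leqNgt; apply: H; rewrite inE.
pose f v : R := #|B v :&: C v|%:R + #|B v|%:R + #|C v|%:R.
have f1 v : 3 <= f v.
  have le1 (S : {set 'I_M}) : v \in S -> 1 <= #|S|%:R :> R.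
    by move=> vS; rewrite ler1n; apply/card_gt0P; exists v.
  have := le1 (B v :&: C v); rewrite inE vB vC => /(_ isT).
  by have := le1 _ (vB v); have := le1 _ (vC v); rewrite /f; lra.
have sum_inv : \sum_v 3 / f v <= k%:R :> R.
  have M0 : 0 < M`!%:R :> R by rewrite ltr0n fact_gt0.
  rewrite -(ler_pM2r M0) mulr_suml.
  apply: (@le_trans _ _ (\sum_v #|first_in (B v) v :|: first_in (C v) v|%:R)).
    apply: ler_sum => v _.
    have E : #|first_in (B v) v :|: first_in (C v) v|%:R
      = (#|B v|%:R^-1 + #|C v|%:R^-1 - #|B v :|: C v|%:R^-1) * M`!%:R :> R.
      rewrite cardsU -first_inU natrB ?first_inU; last first.
        by rewrite (leq_trans (subset_leq_card (subsetIl _ _))) ?leq_addr.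
      rewrite natrD -first_inU !first_in_ratio ?inE ?irr //; ring.
    rewrite E; apply: ler_wpM2r; [exact: ltW|apply: inv_sum_bound].
    - by rewrite ler1n; apply/card_gt0P; exists v; rewrite inE vB vC.
    - by rewrite ler_nat subset_leq_card ?subsetIl.
    - by rewrite ler_nat subset_leq_card ?subsetIr.
    - by rewrite -!natrD cardsUI.
  rewrite -natr_sum -natrM ler_nat.
  under eq_bigr do rewrite -sum1_card.
  rewrite (exchange_big_dep predT) //= -card_Sn mulnC -sum_nat_const.
  rewrite [leqRHS](eq_bigl predT); last by move=> s; rewrite inE.
  apply: leq_sum => s _; rewrite sum1_card; apply: leq_trans (leA s).
  by rewrite subset_leq_card //; apply/subsetP => v; rewrite [in X in _ -> X]inE.
have -> : \sum_u \sum_v ((~~ e u v && ~~ e v u)%:R + (~~ e u v)%:R + (~~ e v u)%:R)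
   = \sum_v f v.
  apply: eq_bigr => u _; rewrite !big_split /= /f -!natr_sum -!sum1_card.
  by congr (_%:R + _%:R + _%:R); rewrite [in RHS]big_mkcond /=; apply: eq_bigr => v _;
    rewrite !inE // andbC; case: ifP.
have [M0|Mp] := posnP M.
  by rewrite [in leLHS]M0 expr0n mulr0 mulr_ge0 ?ler0n // sumr_ge0 // => v _; have := f1 v; lra.
set F := \sum_v f v.
have F0 : 0 < F.
  apply: (@lt_le_trans _ _ (\sum_(v < M) 3)); last by apply: ler_sum => v _; apply: f1.
  by rewrite sumr_const card_ord -[_ *+ M]mulr_natr mulr_gt0 ?ltr0n.
(* AM-GM in the form [1 / f >= 2 q - q^2 f] for [q = M / F] replaces Cauchy-Schwarz. *)
pose q : R := M%:R / F.
have : \sum_v 3 * (2 * q - q ^+ 2 * f v) <= k%:R.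
  apply: le_trans sum_inv; apply: ler_sum => v _.
  have fp : 0 < f v by have := f1 v; lra.
  rewrite ler_wpM2l // -subr_ge0.
  have -> : (f v)^-1 - (2 * q - q ^+ 2 * f v) = (1 - q * f v) ^+ 2 / f v.
    by field; rewrite lt0r_neq0.
  by rewrite mulr_ge0 ?sqr_ge0 // invr_ge0 ltW.
rewrite -mulr_sumr sumrB sumr_const card_ord -mulr_sumr -/F -[_ *+ M]mulr_natr => H.
have qF : q * F = M%:R by rewrite divfK // lt0r_neq0.
have : 3 * (q ^+ 2 * F) * F <= k%:R * F.
  apply: ler_wpM2r; first exact: ltW.
  by move: H; rewrite -qF; lra.
by rewrite -qF; have -> : 3 * (q * F) ^+ 2 = 3 * (q ^+ 2 * F) * F by ring.
Qed.

(** * Weighted densities and sampling *)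

Definition bidir (V : Type) (e : rel V) : rel V := fun u v => e u v && e v u.

Definition wt (R : realFieldType) (V : Type) (a : R) (e : rel V) (u v : V) : R :=
  if bidir e u v then a else (e u v || e v u)%:R.

Lemma wtC (R : realFieldType) (V : Type) (a : R) (e : rel V) u v :
  wt a e u v = wt a e v u.
Proof. by rewrite /wt /bidir andbC orbC. Qed.

Lemma wt_ge0 (R : realFieldType) (V : Type) (a : R) (e : rel V) u v :
  1 <= a -> 0 <= wt a e u v.
Proof. by move=> a1; rewrite /wt; case: ifP => _; [lra|rewrite ler0n]. Qed.

Lemma wt_le (R : realFieldType) (V : Type) (a : R) (e : rel V) u v :
  1 <= a -> wt a e u v <= a.
Proof. by move=> a1; rewrite /wt; case: ifP => // _; case: (_ || _) => /=; lra. Qed.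

(* The coefficients are determined by the three values of the weight: the defects of [e]
   and of [bidir e] are 0, 0 on a double edge, 1, 3 on a single one, and 3, 3 on a nonedge. *)
Lemma wt_defect (R : realFieldType) (V : Type) (a : R) (e : rel V) u v :
  wt a e u v = a
    - 2^-1 * ((~~ e u v && ~~ e v u)%:R + (~~ e u v)%:R + (~~ e v u)%:R)
    - (a - 3 / 2) / 3 * ((~~ bidir e u v && ~~ bidir e v u)%:R
                         + (~~ bidir e u v)%:R + (~~ bidir e v u)%:R).
Proof.
by rewrite /wt /bidir; case: (e u v); case: (e v u); rewrite /= ?addr0 ?add0r; field.
Qed.

(** [wt_defect] splits the weight into the defects of [e] and of [bidir e], and
    [pairwise_random_order] bounds each. The second coefficient is positive because [a > 3/2], so a
    smaller [s] yields a better bound. *)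
Lemma wt_sum_le (R : realFieldType) (a : R) (r s M : nat) (e : rel 'I_M) :
    3 / 2 < a -> (0 < r)%N -> (0 < s)%N -> (forall v, e v v = false) ->
    (forall L, pairwise e L -> (size L <= r)%N) ->
    (forall L, pairwise (bidir e) L -> (size L <= s)%N) ->
  \sum_u \sum_v wt a e u v <= (a - 3 / 2 / r%:R - (a - 3 / 2) / s%:R) * M%:R ^+ 2.
Proof.
move=> a32 r0 s0 irr Lr Ls.
have := pairwise_random_order R irr Lr.
have irr2 v : bidir e v v = false by rewrite /bidir irr.
have := pairwise_random_order R irr2 Ls.
set H2 := \sum_u _; set H1 := \sum_u _ => le2 le1.
have -> : \sum_u \sum_v wt a e u v = a * M%:R ^+ 2 - 2^-1 * H1 - (a - 3 / 2) / 3 * H2.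
  under eq_bigr => u _ do under eq_bigr => v _ do rewrite wt_defect.
  under eq_bigr => u _ do rewrite !sumrB -!mulr_sumr sumr_const card_ord.
  rewrite !sumrB -!mulr_sumr sumr_const card_ord -/H1 -/H2 expr2.
  by rewrite -mulrnA -[a *+ _]mulr_natr natrM.
have r0' : 0 < r%:R :> R by rewrite ltr0n.
have s0' : 0 < s%:R :> R by rewrite ltr0n.
have le1' : 3 * M%:R ^+ 2 / r%:R <= H1 by rewrite ler_pdivrMr // [H1 * _]mulrC.
have le2' : 3 * M%:R ^+ 2 / s%:R <= H2 by rewrite ler_pdivrMr // [H2 * _]mulrC.
have b0 : 0 <= (a - 3 / 2) / 3 by lra.
have := ler_wpM2l b0 le2'.
have -> : (a - 3 / 2) / 3 * (3 * M%:R ^+ 2 / s%:R) = (a - 3 / 2) / s%:R * M%:R ^+ 2.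
  by field; rewrite lt0r_neq0.
have -> : (a - 3 / 2 / r%:R - (a - 3 / 2) / s%:R) * M%:R ^+ 2 =
  a * M%:R ^+ 2 - (3 * M%:R ^+ 2 / r%:R) / 2 - (a - 3 / 2) / s%:R * M%:R ^+ 2.
  by field; rewrite !lt0r_neq0.
lra.
Qed.

(** Distinct coordinates of an independent sample are again an independent sample: for a prescribed
    value [p] on [i], the sum over [f] factors over the coordinates, and each coordinate outside [i]
    contributes 1. *)
Lemma iid_marginal (R : realFieldType) (V : finType) (x : V -> R) (k M : nat)
    (i : k.-tuple 'I_M) (F : k.-tuple V -> R) :
    \sum_v x v = 1 -> uniq i ->
  \sum_(f : {ffun 'I_M -> V}) (\prod_j x (f j)) * F [tuple of map f i]
    = \sum_(p : k.-tuple V) (\prod_(v <- p) x v) * F p.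
Proof.
move=> x1 ui.
rewrite (partition_big (fun f : {ffun 'I_M -> V} => [tuple of map f i]) predT) //=.
apply: eq_bigr => p _; rewrite (eq_bigr (fun f : {ffun 'I_M -> V} => (\prod_j x (f j)) * F p)).
  2: by move=> f /eqP ->.
rewrite -mulr_suml; congr (_ * _).
pose g j u := x u * [forall l, (tnth i l == j) ==> (tnth p l == u)]%:R.
transitivity (\prod_j \sum_u g j u).
  rewrite bigA_distr_bigA big_mkcond /=; apply: eq_bigr => f _.
  rewrite big_split /= -natr_prod.
  case: eqP => [E|ne].
    rewrite [X in _ * X%:R]big1 ?mulr1 // => j _.
    suff -> : [forall l, (tnth i l == j) ==> (tnth p l == f j)] by [].
    by apply/forallP => l; apply/implyP => /eqP <-; rewrite -E tnth_map.
  suff [j Hj] : exists j, [forall l, (tnth i l == j) ==> (tnth p l == f j)] = false.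
    by rewrite [X in _ * X%:R](bigD1 j) //= Hj mul0n mulr0.
  have /existsP[l nl] : [exists l, tnth p l != f (tnth i l)].
    rewrite -negb_forall; apply/forallP => all; apply: ne.
    by apply: eq_from_tnth => l; rewrite tnth_map (eqP (all l)).
  by exists (tnth i l); apply/negP => /forallP/(_ l); rewrite eqxx /= (negPf nl).
rewrite (bigID (mem i)) /= [X in _ * X]big1 ?mulr1 => [|j ji]; last first.
  rewrite -[RHS]x1; apply: eq_bigr => u _; rewrite /g.
  suff -> : [forall l, (tnth i l == j) ==> (tnth p l == u)] by rewrite mulr1.
  by apply/forallP => l; apply/implyP => /eqP E; rewrite -E mem_tnth in ji.
rewrite -big_uniq // [RHS]big_tuple. rewrite [LHS]big_tuple; apply: eq_bigr => l _.
rewrite (bigD1 (tnth p l)) //= big1 ?addr0 => [|u ne]; rewrite /g.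
  suff -> : [forall m, (tnth i m == tnth i l) ==> (tnth p m == tnth p l)] by rewrite mulr1.
  by apply/forallP => m; apply/implyP => /eqP/(tuple_uniqP i ui) ->.
suff -> : [forall m, (tnth i m == tnth i l) ==> (tnth p m == u)] = false by rewrite mulr0.
by apply/negP => /forallP/(_ l); rewrite eqxx /= eq_sym (negPf ne).
Qed.

Lemma big_tupleS (R : nmodType) (T : finType) (k : nat) (F : k.+1.-tuple T -> R) :
  \sum_p F p = \sum_v \sum_(p : k.-tuple T) F (cons_tuple v p).
Proof.
rewrite pair_bigA /= (reindex (fun vp : T * k.-tuple T => cons_tuple vp.1 vp.2)) //.
apply: onW_bij; exists (fun p => (thead p, behead_tuple p)).
  by case=> v p /=; congr (_, _); apply: val_inj.
by move=> p; rewrite [RHS]tuple_eta; apply: val_inj.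
Qed.

Lemma big_tuple0 (R : nmodType) (T : finType) (F : 0.-tuple T -> R) :
  \sum_p F p = F [tuple].
Proof. by rewrite (big_pred1 [tuple]) // => p; apply/esym/eqP; rewrite tuple0. Qed.

Lemma irr_pairwise_uniq (V : eqType) (e : rel V) (L : seq V) :
  (forall v, e v v = false) -> pairwise e L -> uniq L.
Proof.
move=> irr; rewrite uniq_pairwise; apply: sub_pairwise => u v euv /=.
by apply: contraTneq euv => ->; rewrite irr.
Qed.

(** Densities are taken with respect to a probability distribution [x] on the vertices, since the
    bound on low degrees comes from perturbing the uniform one. *)
Definition wdens (R : realFieldType) (V : finType) (x : V -> R) (a : R) (e : rel V) : R :=
  \sum_u \sum_v x u * x v * wt a e u v.

Definition tdens (R : realFieldType) (V : finType) (x : V -> R) (e : rel V) (k : nat) : R :=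
  \sum_(p : k.-tuple V) (\prod_(v <- p) x v) * (pairwise e p)%:R.

Section Sampling.
Variables (R : realFieldType) (V : finType) (x : V -> R).
Hypotheses (x_ge0 : forall v, 0 <= x v) (sum_x : \sum_v x v = 1).

Lemma iid_pair (M : nat) (j1 j2 : 'I_M) (w : V -> V -> R) : j1 != j2 ->
  \sum_(f : {ffun 'I_M -> V}) (\prod_j x (f j)) * w (f j1) (f j2)
    = \sum_u \sum_v x u * x v * w u v.
Proof.
move=> ne.
have u12 : uniq [tuple j1; j2] by rewrite /= inE ne.
pose F (p : 2.-tuple V) := w (tnth p ord0) (tnth p (lift ord0 ord0)).
transitivity (\sum_(f : {ffun 'I_M -> V})
    (\prod_j x (f j)) * F [tuple of map f [tuple j1; j2]]).
  by apply: eq_bigr => f _; rewrite /F !tnth_map.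
rewrite iid_marginal //.
rewrite big_tupleS; apply: eq_bigr => u _; rewrite big_tupleS; apply: eq_bigr => v _.
by rewrite big_tuple0 !big_cons big_nil mulr1 /F !(tnth_nth u).
Qed.

Lemma iid_total (M : nat) : \sum_(f : {ffun 'I_M -> V}) (\prod_j x (f j)) = 1 :> R.
Proof. by rewrite -(bigA_distr_bigA (fun _ => x)) big1. Qed.

Lemma iid_pairwise_count (M k : nat) (e : rel V) :
  \sum_(f : {ffun 'I_M -> V}) (\prod_j x (f j)) *
     (\sum_(i : k.-tuple 'I_M | uniq i) (pairwise e (map f i))%:R)
   <= M%:R ^+ k * tdens x e k.
Proof.
under eq_bigr do rewrite mulr_sumr.
rewrite exchange_big /=.
rewrite (eq_bigr (fun _ => tdens x e k)); last first.
  by move=> i ui; rewrite (iid_marginal (fun p : k.-tuple V => (pairwise e p)%:R)).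
have t0 : 0 <= tdens x e k.
  by apply: sumr_ge0 => p _; rewrite mulr_ge0 // prodr_ge0.
rewrite sumr_const -[leLHS]mulr_natl; apply: ler_wpM2r => //.
by rewrite -natrX ler_nat -[X in (_ <= X ^ _)%N]card_ord -card_tuple max_card.
Qed.

(** [M] independent vertices induce a digraph [D] on the indices. If [D] has no forbidden tuple, its
    weight is at most [L M ^ 2]; otherwise the trivial bound [a M ^ 2] is charged to the number of
    forbidden tuples. The diagonal has weight 0, whence [M (M - 1)] on the left. *)
Lemma sampling_bound (a L : R) (r s M : nat) (e : rel V) :
    1 <= a -> 0 <= L -> (forall v, e v v = false) ->
    (forall D : rel 'I_M, (forall v, D v v = false) ->
      (forall l, pairwise D l -> (size l <= r)%N) ->
      (forall l, pairwise (bidir D) l -> (size l <= s)%N) ->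
      \sum_u \sum_v wt a D u v <= L * M%:R ^+ 2) ->
  M%:R * (M%:R - 1) * wdens x a e <= L * M%:R ^+ 2 +
     a * M%:R ^+ 2 * (M%:R ^+ r.+1 * tdens x e r.+1 + M%:R ^+ s.+1 * tdens x (bidir e) s.+1).
Proof.
move=> a1 L0 irr free.
have -> : M%:R * (M%:R - 1) * wdens x a e =
    \sum_(f : {ffun 'I_M -> V}) (\prod_j x (f j)) * (\sum_i \sum_j wt a e (f i) (f j)).
  under [RHS]eq_bigr do rewrite mulr_sumr.
  rewrite exchange_big /=.
  rewrite (eq_bigr (fun _ => (M%:R - 1) * wdens x a e)).
    by rewrite sumr_const card_ord -[RHS]mulr_natl mulrA.
  move=> i _; under eq_bigr do rewrite mulr_sumr.
  rewrite exchange_big /= (bigD1 i) //= big1 ?add0r => [|f _]; last first.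
    by rewrite /wt /bidir irr mulr0.
  rewrite (eq_bigr (fun _ => wdens x a e)) => [|j ne]; last by rewrite iid_pair // eq_sym.
  rewrite sumr_const -[LHS]mulr_natl; congr (_ * _).
  have := cardC1 i; rewrite card_ord => ->.
  by rewrite -subn1 natrB // (leq_ltn_trans (leq0n i)).
pose cnt k (e' : rel V) (f : {ffun 'I_M -> V}) : R :=
  \sum_(i : k.-tuple 'I_M | uniq i) (pairwise e' (map f i))%:R.
have cnt0 k e' f : 0 <= cnt k e' f by apply: sumr_ge0.
have cnt1 k e' (f : {ffun 'I_M -> V}) l : (forall v, e' v v = false) ->
    pairwise e' (map f l) -> (k < size l)%N -> 1 <= cnt k.+1 e' f.
  move=> irr' pl kl.
  have st : size (take k.+1 l) == k.+1 by rewrite size_takel.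
  have pt : pairwise e' (map f (Tuple st)).
    by rewrite /= map_take (subseq_pairwise (take_subseq _ _)).
  rewrite /cnt (bigD1 (Tuple st)) /=; last by rewrite (map_uniq (irr_pairwise_uniq irr' pt)).
  by rewrite pt lerDl sumr_ge0.
apply: (@le_trans _ _ (\sum_(f : {ffun 'I_M -> V}) (\prod_j x (f j)) *
   (L * M%:R ^+ 2 + a * M%:R ^+ 2 * (cnt r.+1 e f + cnt s.+1 (bidir e) f)))).
  apply: ler_sum => f _; apply: ler_wpM2l; first exact: prodr_ge0.
  pose D : rel 'I_M := relpre f e.
  have aM : 0 <= a * M%:R ^+ 2 by rewrite mulr_ge0 ?sqr_ge0 //; lra.
  have LM : 0 <= L * M%:R ^+ 2 by rewrite mulr_ge0 ?sqr_ge0.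
  have trivial_bound : \sum_i \sum_j wt a e (f i) (f j) <= a * M%:R ^+ 2.
    apply: (@le_trans _ _ (\sum_(i < M) \sum_(j < M) a)).
      by apply: ler_sum => i _; apply: ler_sum => j _; exact: wt_le.
    by rewrite !sumr_const !card_ord -mulrnA -[a *+ _]mulr_natr natrM expr2.
  have big_cnt : 1 <= cnt r.+1 e f + cnt s.+1 (bidir e) f ->
      \sum_i \sum_j wt a e (f i) (f j)
        <= L * M%:R ^+ 2 + a * M%:R ^+ 2 * (cnt r.+1 e f + cnt s.+1 (bidir e) f).
    by move=> c1; have := ler_wpM2l aM c1; lra.
  have irr2 v : bidir e v v = false by rewrite /bidir irr.
  have [c1|c1] := leP 1 (cnt r.+1 e f + cnt s.+1 (bidir e) f); first exact: big_cnt.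
  apply: (@le_trans _ _ (L * M%:R ^+ 2)); last first.
    by rewrite lerDl mulr_ge0 ?addr_ge0.
  apply: (free D) => [v|l|l]; first exact: irr.
    rewrite leqNgt -pairwise_map => pl; apply/negP => /(cnt1 _ _ _ _ irr pl).
    by have := cnt0 s.+1 (bidir e) f; lra.
  rewrite leqNgt => pl; apply/negP => kl.
  have pl2 : pairwise (bidir e) (map f l) by rewrite pairwise_map.
  by have := cnt1 _ _ _ _ irr2 pl2 kl; have := cnt0 r.+1 e f; lra.
under eq_bigr do rewrite mulrDr [X in _ + X]mulrCA mulrDr.
rewrite big_split /= -mulr_suml iid_total mul1r lerD2l -mulr_sumr big_split /=.
apply: ler_wpM2l; first by rewrite mulr_ge0 ?sqr_ge0 //; lra.
by apply: lerD; exact: iid_pairwise_count.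
Qed.

End Sampling.

Lemma wdens_le (R : realFieldType) (V : finType) (x : V -> R) (a : R) (e : rel V) :
  1 <= a -> (forall v, 0 <= x v) -> \sum_v x v = 1 -> wdens x a e <= a.
Proof.
move=> a1 x0 x1; apply: (@le_trans _ _ (\sum_u \sum_v x u * x v * a)).
  apply: ler_sum => u _; apply: ler_sum => v _.
  by apply: ler_wpM2l; [rewrite mulr_ge0|rewrite wt_le].
under eq_bigr do rewrite -mulr_suml -mulr_sumr x1 mulr1.
by rewrite -mulr_suml x1 mul1r.
Qed.

Lemma wdens_le_limit (R : realType) (a eps : R) (r s : nat) :
    3 / 2 < a -> (0 < r)%N -> (0 < s)%N -> 0 < eps ->
  exists2 d : R, 0 < d & forall (V : finType) (x : V -> R) (e : rel V),
    (forall v, 0 <= x v) -> \sum_v x v = 1 -> (forall v, e v v = false) ->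
    tdens x e r.+1 <= d -> tdens x (bidir e) s.+1 <= d ->
    wdens x a e <= a - 3 / 2 / r%:R - (a - 3 / 2) / s%:R + eps.
Proof.
move=> a32 r0 s0 eps0.
set L := a - _ - _.
have L0 : 0 <= L.
  have inv_le1 k : (0 < k)%N -> k%:R^-1 <= 1 :> R.
    by move=> k0; rewrite invf_le1 ?ltr0n // ler1n.
  have b0 : 0 <= a - 3 / 2 by lra.
  have := ler_wpM2l b0 (inv_le1 _ s0); have := inv_le1 _ r0; rewrite /L; lra.
(* The sample size depends on [a] and [eps] only. Passing from [M (M - 1)] to [M ^ 2] costs at most
   [a M <= eps / 2 M ^ 2]; the choice of [d] below lets the forbidden tuples cost at most the
   same. *)
pose M := (Num.Def.archi_bound (2 * a / eps)).+1.
have Ma : 2 * a <= eps * M%:R.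
  rewrite [eps * _]mulrC -ler_pdivrMr // ltW //.
  have ae0 : 0 <= 2 * a / eps by apply: divr_ge0; lra.
  by apply: lt_le_trans (archi_boundP ae0) _; rewrite ler_nat.
have M0 : 0 < M%:R :> R by rewrite ltr0n.
set P : R := M%:R ^+ r.+1 + M%:R ^+ s.+1.
have P0 : 0 < P by rewrite addr_gt0 // exprn_gt0.
exists (eps / (2 * a * P)); first by rewrite divr_gt0 // mulr_gt0 //; lra.
move=> V x e x0 x1 irr te tb.
have a1 : 1 <= a by lra.
have := sampling_bound (M := M) x0 x1 a1 L0 irr
  (fun D irrD Lr Ls => wt_sum_le a32 r0 s0 irrD Lr Ls).
set w := wdens _ _ _ => main.
have wa : w <= a by apply: wdens_le.
set T := M%:R ^+ r.+1 * _ + _ in main.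
have T_le : a * T <= eps / 2.
  have -> : eps / 2 = a * (P * (eps / (2 * a * P))) by field; rewrite lt0r_neq0 //=; lra.
  apply: ler_wpM2l; first lra.
  by rewrite /T /P mulrDl; apply: lerD; apply: ler_wpM2l => //; rewrite exprn_ge0 // ltW.
rewrite -(ler_pM2l (exprn_gt0 2 M0)).
have := ler_wpM2l (sqr_ge0 (M%:R : R)) T_le.
have := ler_wpM2l (ltW M0) wa.
have := ler_wpM2l (ltW M0) Ma.
move: main.
clear; move: (M%:R : R) (w) (T) (L) => m {}w {}T {}L; lra.
Qed.

Lemma tdens_bidir_le (R : realFieldType) (V : finType) (x : V -> R) (e : rel V) (k : nat) :
  (forall v, 0 <= x v) -> tdens x (bidir e) k <= tdens x e k.
Proof.
move=> x0; apply: ler_sum => p _; apply: ler_wpM2l; first exact: prodr_ge0.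
have sub : subrel (bidir e) e by move=> u v /andP[].
by rewrite ler_nat; case E: (pairwise (bidir e) p) => //; move: E => /(sub_pairwise sub) ->.
Qed.

Lemma wdens_turan (R : realType) (a eps : R) (r : nat) :
    3 / 2 < a -> (0 < r)%N -> 0 < eps ->
  exists2 d : R, 0 < d & forall (V : finType) (x : V -> R) (e : rel V),
    (forall v, 0 <= x v) -> \sum_v x v = 1 -> (forall v, e v v = false) ->
    tdens x e r.+1 <= d -> wdens x a e <= a * (1 - r%:R^-1) + eps.
Proof.
move=> a32 r0 eps0; have [d d0 H] := wdens_le_limit a32 r0 r0 eps0.
exists d => // V x e x0 x1 irr te.
have := H V x e x0 x1 irr te (le_trans (tdens_bidir_le _ _ x0) te); lra.
Qed.

(** This is the limit bound with [s = r - 1] in place of [s = r]: it improves by [g], half of which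
    is given up as [eps]. *)
Lemma wdens_gap (R : realType) (a : R) (r : nat) :
    3 / 2 < a -> (1 < r)%N ->
  exists2 d : R, 0 < d & forall (V : finType) (x : V -> R) (e : rel V),
    (forall v, 0 <= x v) -> \sum_v x v = 1 -> (forall v, e v v = false) ->
    tdens x e r.+1 <= d -> tdens x (bidir e) r <= d ->
    wdens x a e <= a * (1 - r%:R^-1) - d.
Proof.
case: r => [|[|s]] // a32 _.
set r := s.+2.
have inv_lt : r%:R^-1 < s.+1%:R^-1 :> R by rewrite ltf_pV2 ?posrE ?ltr0n // ltr_nat.
pose g := (a - 3 / 2) * (s.+1%:R^-1 - r%:R^-1).
have g0 : 0 < g by apply: mulr_gt0; rewrite subr_gt0.
have g2 : 0 < g / 2 by lra.
have [d d0 H] := wdens_le_limit a32 (ltn0Sn s.+1) (ltn0Sn s) g2.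
exists (Num.min d (g / 2)) => [|V x e x0 x1 irr te tb]; first by rewrite lt_min d0 g2.
have ld : Num.min d (g / 2) <= d by rewrite ge_min lexx.
have lg : Num.min d (g / 2) <= g / 2 by rewrite ge_min lexx orbT.
have := H V x e x0 x1 irr (le_trans te ld) (le_trans tb ld).
move: lg; rewrite -/r; move: (Num.min _ _) (wdens x a e) => m w; rewrite /g.
by move: (r%:R^-1 : R) (s.+1%:R^-1 : R) => p q; lra.
Qed.

(** * Complete partite subhypergraphs *)

(** A supporting line of the power function at [y], its slope built up by the product rule. Summed
    over [i], it gives Jensen's inequality in [sum_exprn_ge]. *)
Lemma exprn_tangent (R : realFieldType) (y : R) (t : nat) : 0 <= y ->
  exists2 c, 0 <= c & forall x, 0 <= x -> c * (x - y) <= x ^+ t - y ^+ t.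
Proof.
move=> y0; elim: t => [|t [c c0 IH]]; first by exists 0 => // x _; rewrite mul0r subrr.
exists (c * y + y ^+ t); first by rewrite addr_ge0 ?mulr_ge0 ?exprn_ge0.
move=> x x0; rewrite !exprS.
have := ler_wpM2l x0 (IH x x0); have := mulr_ge0 c0 (sqr_ge0 (x - y)).
by move: (x ^+ t) (y ^+ t) => X Y; lra.
Qed.

Lemma sum_exprn_ge (R : realFieldType) (I : finType) (d : I -> R) (y : R) (t : nat) :
    0 <= y -> (forall i, 0 <= d i) -> #|I|%:R * y <= \sum_i d i ->
  #|I|%:R * y ^+ t <= \sum_i d i ^+ t.
Proof.
move=> y0 d0 le_sum; have [c c0 H] := exprn_tangent t y0.
rewrite -subr_ge0; apply: (@le_trans _ _ (c * (\sum_i d i - #|I|%:R * y))).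
  by rewrite mulr_ge0 // subr_ge0.
rewrite !mulr_natl -!sumr_const -!sumrB mulr_sumr.
by apply: ler_sum => i _; exact: H.
Qed.

(** Bounds the number of non-injective [t]-tuples by [t ^ 2 n ^ (t - 1)], multiplied by [n] to avoid
    the exponent [t - 1]. *)
Lemma ffact_ge (R : realFieldType) (n t : nat) :
  n%:R ^+ t.+1 - (n ^_ t)%:R * n%:R <= t%:R ^+ 2 * n%:R ^+ t :> R.
Proof.
elim: t => [|t IH]; first by rewrite ffactn0 expr1 mul1r subrr expr0n mul0r.
rewrite ffactnSr natrM.
have n0 : 0 <= n%:R :> R by [].
have t0 : 0 <= t%:R :> R by [].
have f0 : 0 <= (n ^_ t)%:R :> R by [].
have sub : n%:R - t%:R <= (n - t)%:R :> R.
  by rewrite lerBlDr -natrD ler_nat; lia.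
have ffact_le : (n ^_ t)%:R <= n%:R ^+ t :> R.
  rewrite -natrX ler_nat; elim: (t) => // s IHs.
  by rewrite ffactnSr expnSr leq_mul // leq_subr.
have := ler_wpM2l (mulr_ge0 f0 n0) sub.
have := ler_wpM2l n0 IH.
have := ler_wpM2l (mulr_ge0 t0 n0) ffact_le.
have tn0 : 0 <= (t%:R + 1) * n%:R ^+ t * n%:R :> R.
  by rewrite !mulr_ge0 ?exprn_ge0 // addr_ge0.
move: tn0; rewrite -natr1 !exprS.
move: (n%:R ^+ t : R) ((n ^_ t)%:R : R) ((n - t)%:R : R) (n%:R : R) (t%:R : R).
by move=> X F D N T; lra.
Qed.

Lemma mkseqSl (T : Type) (f : nat -> T) (k : nat) :
  mkseq f k.+1 = f 0 :: mkseq (fun i => f i.+1) k.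
Proof. by rewrite /mkseq /= (iotaDl 1 0 k) -map_comp. Qed.

(* Erdos' theorem on complete [k]-partite subhypergraphs: the first coordinate is blown up
   to an injective [t]-tuple [B] by convexity, and the induction hypothesis is applied to
   the [k]-tuples that complete every entry of [B]. *)
Lemma dense_has_box (R : realType) (t k : nat) (d : R) : 0 < d ->
  exists n0, forall V : finType, (n0 <= #|V|)%N -> forall P : pred (seq V),
    d * #|V|%:R ^+ k <= \sum_(p : k.-tuple V) (P p)%:R ->
  exists B : nat -> 'I_t -> V, (forall i, (i < k)%N -> injective (B i)) /\
    forall c : nat -> 'I_t, P (mkseq (fun i => B i (c i)) k).
Proof.
elim: k d => [|k IH] d d0.
  exists 1 => V /card_gt0P[v0 _] P; rewrite expr0 mulr1 big_tuple0 => dP.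
  by exists (fun _ _ => v0); split=> // c; move: dP => /=; case: (P [::]) => //; rewrite leNgt d0.
have dt0 : 0 < d ^+ t / 2 by rewrite divr_gt0 ?exprn_gt0.
have [n0 H] := IH _ dt0.
(* Beyond this size the non-injective tuples account for less than half of the total
   [d ^ t n ^ t n ^ k]. *)
pose z : R := t%:R ^+ 2 / (d ^+ t / 2).
exists (maxn n0 (Num.Def.archi_bound z).+1) => V; rewrite geq_max => /andP[n0V zV] P dP.
set n : R := #|V|%:R in dP.
have n_gt0 : 0 < n by rewrite ltr0n; apply: leq_trans zV.
have z0 : 0 <= z by rewrite divr_ge0 ?sqr_ge0 // ltW.
have zn : t%:R ^+ 2 < d ^+ t / 2 * n.
  rewrite [_ * n]mulrC -ltr_pdivrMr //; apply: lt_le_trans (archi_boundP z0) _.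
  by rewrite ler_nat ltnW.
pose PB (B : {ffun 'I_t -> V}) (s : seq V) := [forall x, P (B x :: s)].
have [B injB dB] : exists2 B : {ffun 'I_t -> V}, injectiveb B &
    d ^+ t / 2 * n ^+ k <= \sum_(q : k.-tuple V) (PB B q)%:R.
  (* Otherwise injective tuples would contribute at most half of the lower bound [total], and the
     non-injective ones less than the other half. *)
  apply/exists_inP; apply: contraT; rewrite negb_exists_in => /forall_inP small.
  have total : n ^+ k * (d * n) ^+ t <= \sum_B \sum_(q : k.-tuple V) (PB B q)%:R.
    rewrite exchange_big /=.
    have := @sum_exprn_ge R (k.-tuple V) (fun q => \sum_v (P (v :: q))%:R) (d * n) t.
    rewrite card_tuple natrX -/n => /(_ _ _ _)/le_trans; apply.
    - by rewrite mulr_ge0 // ltW.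
    - by move=> q; apply: sumr_ge0.
    - by move: dP; rewrite big_tupleS exchange_big /= exprSr; lra.
    apply: ler_sum => q _; rewrite -[X in _ ^+ X](card_ord t) -prodr_const.
    rewrite (bigA_distr_bigA (fun _ v => (P (v :: q))%:R)) /=.
    apply: ler_sum => B _; rewrite -natr_prod ler_nat.
    case: (boolP (PB B q)) => [/forallP all1|/forallPn[x nx]].
      by rewrite big1 // => x _; rewrite all1.
    by rewrite (bigD1 x) //= (negPf nx) mul0n.
  rewrite (bigID (fun B : {ffun 'I_t -> V} => injectiveb B)) /= in total.
  have bound_inj : \sum_(B : {ffun 'I_t -> V} | injectiveb B) \sum_(q : k.-tuple V) (PB B q)%:R
      <= n ^+ t * (d ^+ t / 2 * n ^+ k).
    apply: (@le_trans _ _ (\sum_(B : {ffun 'I_t -> V} | injectiveb B) (d ^+ t / 2 * n ^+ k))).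
      by apply: ler_sum => B /small; rewrite -ltNge => /ltW.
    rewrite sumr_const -[leLHS]mulr_natl; apply: ler_wpM2r.
      by rewrite mulr_ge0 ?exprn_ge0 // ltW.
    by rewrite -natrX ler_nat (leq_trans (max_card _)) // card_ffun card_ord.
  have bound_ninj : (\sum_(B : {ffun 'I_t -> V} | ~~ injectiveb B)
      \sum_(q : k.-tuple V) (PB B q)%:R) * n <= t%:R ^+ 2 * n ^+ t * n ^+ k.
    apply: (@le_trans _ _ ((\sum_(B : {ffun 'I_t -> V} | ~~ injectiveb B) n ^+ k) * n)).
      apply: ler_wpM2r; first exact: ltW.
      apply: ler_sum => B _; rewrite -natrX -card_tuple -sum1_card natr_sum.
      by apply: ler_sum => q _; case: (PB B q); rewrite ?ler01.
    rewrite sumr_const -[_ *+ _]mulr_natl mulrAC; apply: ler_wpM2r.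
      by rewrite exprn_ge0 // ltW.
    apply: le_trans (ffact_ge _ _ _); rewrite exprSr -mulrBl.
    apply: ler_wpM2r; first exact: ltW.
    have := cardC [pred f : {ffun 'I_t -> V} | injectiveb f].
    have := card_inj_ffuns 'I_t V; rewrite cardsE card_ord => ->.
    by rewrite card_ffun card_ord /n -natrX => <-; rewrite natrD [X in X - _]addrC addrK.
  have nk : 0 < n ^+ k * n ^+ t by rewrite mulr_gt0 ?exprn_gt0.
  have := ler_wpM2r (ltW n_gt0) total; rewrite mulrDl exprMn.
  have := ler_wpM2r (ltW n_gt0) bound_inj.
  have := ltr_pM2r nk (t%:R ^+ 2) (d ^+ t / 2 * n); rewrite zn => le3.
  move: bound_ninj le3.
  move: (\sum_(B | _) _) (\sum_(B | _) _) (n ^+ k) (n ^+ t) (d ^+ t) (t%:R ^+ 2).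
  by move=> A1 A2 N1 N2 D T; lra.
have [B' [injB' box]] := H V n0V (PB B) dB.
exists (fun i => if i is j.+1 then B' j else B : 'I_t -> V); split=> [[_|i]|c].
- exact/injectiveP.
- by rewrite ltnS; exact: injB'.
by rewrite mkseqSl; exact: (forallP (box (fun i => c i.+1)) (c 0)).
Qed.

Definition tnum (V : finType) (e : rel V) (k : nat) : nat :=
  (\sum_(p : k.-tuple V) pairwise e p)%N.

(** Too many transitive tournaments would contain a box, whose sides are the classes of a blow-up.
    Distinct sides are disjoint because a common vertex would carry a loop. *)
Lemma blowup_free_tnum (R : realType) (r t : nat) (d : R) : 0 < d ->
  exists n0, forall n, (n0 <= n)%N -> forall G : rel 'I_n,
    loopless G -> blowup_free r t G -> (tnum G r.+1)%:R <= d * n%:R ^+ r.+1.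
Proof.
move=> d0; have [n0 H] := dense_has_box t r.+1 d0.
exists n0 => n nn G loopG freeG; rewrite leNgt; apply/negP => /ltW many.
have [||B [injB box]] := H 'I_n _ (pairwise G); rewrite ?card_ord //.
  by rewrite -natr_sum.
apply: freeG; exists (fun p : 'I_r.+1 * 'I_t => B p.1 p.2).
(* Any two vertices on distinct sides occur in a common selection: [y] on side [i], [z] on all
   others. *)
have arc (i j : 'I_r.+1) (y z : 'I_t) : (i < j)%N -> G (B i y) (B j z).
  move=> ij; pose c l := if l == i :> nat then y else z.
  have /(pairwiseP (B 0 y)) P := box c.
  have := P i j; rewrite !inE size_mkseq !nth_mkseq // => /(_ (ltn_ord _) (ltn_ord _) ij).
  by rewrite /c eqxx gtn_eqF.
split=> [[i y] [j z] /= E|[i y] [j z]]; last exact: arc.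
have ij : i = j.
  apply: val_inj => /=; case: (ltngtP i j) => // lt; have := arc _ _ _ _ lt.
    by move=> /(_ y z); rewrite E (negPf (loopG _)).
  by move=> /(_ z y); rewrite E (negPf (loopG _)).
by rewrite ij; congr (_, _); apply: (injB j) => //; rewrite -E ij.
Qed.

(** * Double cliques and low degrees *)

Definition deg (R : realFieldType) (V : finType) (a : R) (e : rel V) (u : V) : R :=
  \sum_v wt a e u v.

Lemma tdens_le_tnum (R : realFieldType) (V : finType) (x : V -> R) (c : R) (e : rel V) k :
  (forall v, 0 <= x v <= c) -> tdens x e k <= c ^+ k * (tnum e k)%:R.
Proof.
move=> xc; rewrite natr_sum mulr_sumr; apply: ler_sum => p _.
apply: ler_wpM2r => //; rewrite big_tuple.
by rewrite -[X in _ <= _ ^+ X]card_ord -prodr_const; apply: ler_prod => i _; exact: xc.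
Qed.

(** The contrapositive of [wdens_gap] for the uniform distribution. *)
Lemma many_bidir_cliques (R : realType) (a : R) (r : nat) : 3 / 2 < a -> (1 < r)%N ->
  exists2 d : R, 0 < d & forall (V : finType) (e : rel V),
    (0 < #|V|)%N -> (forall v, e v v = false) ->
    (tnum e r.+1)%:R <= d * #|V|%:R ^+ r.+1 ->
    (a * (1 - r%:R^-1) - d) * #|V|%:R ^+ 2 < \sum_u deg a e u ->
    d * #|V|%:R ^+ r < (tnum (bidir e) r)%:R.
Proof.
move=> a32 r1; have [d d0 H] := wdens_gap a32 r1.
exists d => // V e V0 irr few many; rewrite ltNge; apply/negP => few2.
set n : R := #|V|%:R in few many few2.
have n0 : 0 < n by rewrite ltr0n.
pose x (v : V) := n^-1.
have x0 v : 0 <= x v by rewrite invr_ge0 ltW.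
have x1 : \sum_v x v = 1 by rewrite sumr_const -[LHS]mulr_natl mulfV // lt0r_neq0.
have xx v : 0 <= x v <= n^-1 by rewrite x0 lexx.
have bnd k e' : (tnum e' k)%:R <= d * n ^+ k -> tdens x e' k <= d.
  move=> le; apply: le_trans (tdens_le_tnum _ _ xx) _.
  by rewrite exprVn mulrC ler_pdivrMr ?exprn_gt0.
have := H V x e x0 x1 irr (bnd _ _ few) (bnd _ _ few2).
rewrite leNgt => /negP; apply.
rewrite -(ltr_pM2r (exprn_gt0 2 n0)); apply: lt_le_trans many _.
rewrite /wdens mulr_suml; apply: ler_sum => u _; rewrite mulr_suml; apply: ler_sum => v _.
have -> // : x u * x v * wt a e u v * n ^+ 2 = wt a e u v.
by rewrite /x; field; rewrite lt0r_neq0.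
Qed.

(* If many vertices had low degree, giving them weight [1 - eps / 2] instead of [1] would
   push the weighted density above the Turan bound. *)
Lemma few_low_degree (R : realType) (a eps eta : R) (r : nat) :
    3 / 2 < a -> a <= 2 -> (0 < r)%N -> 0 < eps -> eps <= 1 -> 0 < eta ->
  exists2 d : R, 0 < d & forall (V : finType) (e : rel V),
    (0 < #|V|)%N -> (forall v, e v v = false) ->
    (tnum e r.+1)%:R <= d * #|V|%:R ^+ r.+1 ->
    (a * (1 - r%:R^-1) - d) * #|V|%:R ^+ 2 <= \sum_u deg a e u ->
    #|[set v | deg a e v < (a * (1 - r%:R^-1) - eps) * #|V|%:R]|%:R <= eta * #|V|%:R.
Proof.
move=> a32 a2 r0 eps0 eps1 eta0.
have eps2 : 0 < eps ^+ 2 by rewrite exprn_gt0.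
pose eps' := eta * eps ^+ 2 / 4.
have eps'0 : 0 < eps' by rewrite divr_gt0 // mulr_gt0.
have [d1 d10 H] := wdens_turan a32 r0 eps'0.
(* The perturbed distribution is at most [2 / n] at every vertex, so densities of tournaments grow
   by at most [2 ^+ r.+1]. *)
pose d := Num.min (d1 / 2 ^+ r.+1) eps'.
have d0 : 0 < d by rewrite lt_min eps'0 divr_gt0 ?exprn_gt0.
exists d => // V e V0 irr; set n : R := #|V|%:R; set lam := a * _ => few many.
set S := [set v | _]; set m : R := #|S|%:R.
have n0 : 0 < n by rewrite ltr0n.
have m0 : 0 <= m by rewrite ler0n.
have mn : m <= n by rewrite ler_nat max_card.
pose h := eps / 2; pose y v : R := 1 - h * (v \in S)%:R.
have h0 : 0 < h by rewrite divr_gt0.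
have h1 : h <= 2^-1 by rewrite /h; lra.
have y01 v : 2^-1 <= y v <= 1.
  by rewrite /y; case: (v \in S) => /=; rewrite ?mulr1 ?mulr0; lra.
pose X := \sum_v y v.
have XE : X = n - h * m.
  rewrite /X /y sumrB sumr_const -mulr_sumr -natr_sum; congr (_ - _ * _%:R).
  by rewrite -sum1_card [RHS]big_mkcond /=; apply: eq_bigr => v _; case: (v \in S).
have hm : h * m <= n / 2 by have := ler_pM (ltW h0) m0 h1 mn; lra.
have X_ge : n / 2 <= X by rewrite XE; lra.
have X0 : 0 < X by lra.
have xx v : 0 <= y v / X <= 2 / n.
  have /andP[y2 y1] := y01 v.
  rewrite divr_ge0 /=; [|lra|lra].
  by rewrite ler_pdivrMr // mulrAC ler_pdivlMr //; have := ler_wpM2r (ltW n0) y1; lra.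
have x1 : \sum_v y v / X = 1 by rewrite -mulr_suml mulfV // lt0r_neq0.
have td : tdens (fun v => y v / X) e r.+1 <= d1.
  apply: le_trans (tdens_le_tnum _ _ xx) _.
  have c0 : 0 <= (2 / n) ^+ r.+1 by rewrite exprn_ge0 // divr_ge0 // ltW.
  apply: le_trans (ler_wpM2l c0 few) _.
  rewrite expr_div_n mulrA mulrAC mulfVK ?expf_neq0 ?lt0r_neq0 //.
  by rewrite mulrC -ler_pdivlMr ?exprn_gt0 // ge_min lexx.
have := H V (fun v => y v / X) e (fun v => (andP (xx v)).1) x1 irr td.
have wX : wdens (fun v => y v / X) a e * X ^+ 2 = \sum_u \sum_v y u * y v * wt a e u v.
  rewrite /wdens mulr_suml; apply: eq_bigr => u _; rewrite mulr_suml; apply: eq_bigr => v _.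
  by field; rewrite lt0r_neq0.
rewrite -(ler_pM2r (exprn_gt0 2 X0)) wX -/lam => upper.
have a1 : 1 <= a by lra.
(* The weights satisfy [y u y v >= 1 - h [u in S] - h [v in S]], the dropped term being a product of
   nonnegative factors. *)
have lower : \sum_u deg a e u - 2 * h * (m * ((lam - eps) * n))
    <= \sum_u \sum_v y u * y v * wt a e u v.
  have degS : \sum_u \sum_v (u \in S)%:R * wt a e u v <= m * ((lam - eps) * n).
    under eq_bigr do rewrite -mulr_sumr -/(deg _ _ _).
    rewrite /m mulr_natl -sumr_const big_mkcond [leRHS]big_mkcond /=.
    apply: ler_sum => u _; case: ifP => uS; rewrite ?mul1r ?mul0r //.
    by move: uS; rewrite inE => /ltW.
  have degS' : \sum_u \sum_v (v \in S)%:R * wt a e u v <= m * ((lam - eps) * n).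
    by rewrite exchange_big; under eq_bigr do under eq_bigr do rewrite wtC; exact: degS.
  apply: (@le_trans _ _ (\sum_u \sum_v (1 - h * (u \in S)%:R - h * (v \in S)%:R) * wt a e u v)).
    have -> : \sum_u \sum_v (1 - h * (u \in S)%:R - h * (v \in S)%:R) * wt a e u v
      = \sum_u deg a e u - h * (\sum_u \sum_v (u \in S)%:R * wt a e u v)
          - h * (\sum_u \sum_v (v \in S)%:R * wt a e u v).
      rewrite !mulr_sumr -!sumrB; apply: eq_bigr => u _.
      by rewrite !mulr_sumr -!sumrB; apply: eq_bigr => v _; ring.
    have := ler_wpM2l (ltW h0) degS; have := ler_wpM2l (ltW h0) degS'.
    move: (m * _) (\sum_u \sum_v _) (\sum_u \sum_v _) (\sum_u _) (h); clear.
    by move=> z A B C k; lra.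
  apply: ler_sum => u _; apply: ler_sum => v _; apply: ler_wpM2r; first exact: wt_ge0.
  have : 0 <= h ^+ 2 * ((u \in S)%:R * (v \in S)%:R).
    by apply: mulr_ge0; [exact: sqr_ge0|rewrite mulr_ge0].
  by rewrite /y; move: (h) (_%:R) (_%:R); clear => k A B; lra.
have lam2 : lam <= 2.
  have : 0 <= r%:R^-1 :> R by rewrite invr_ge0.
  have : 0 <= a by lra.
  by move=> /mulr_ge0 H1 /H1; rewrite /lam; lra.
have dle : d <= eps' by rewrite ge_min lexx orbT.
have t1 := ler_wpM2r (sqr_ge0 n) dle.
have t2 : lam * (h ^+ 2 * m ^+ 2) <= 2 * (h ^+ 2 * (m * n)).
  have hh : 0 <= h ^+ 2 := sqr_ge0 h.
  have hm0 : 0 <= h ^+ 2 * m ^+ 2 by apply: mulr_ge0 => //; exact: sqr_ge0.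
  apply: (le_trans (ler_wpM2r hm0 lam2)).
  by do 2 apply: ler_wpM2l => //; rewrite expr2; exact: ler_wpM2l.
have t3 : eps' * X ^+ 2 <= eps' * n ^+ 2.
  apply: ler_wpM2l; first exact: ltW.
  have Xn : X <= n by rewrite XE; have := mulr_ge0 (ltW h0) m0; lra.
  by have X0' := ltW X0; rewrite !expr2; exact: ler_pM.
(* With [eps = 2 h], the gain [2 h eps m n = 4 h ^ 2 m n] from the low degrees exceeds twofold the
   quadratic loss [lam h ^ 2 m ^ 2 <= 2 h ^ 2 m n]. The remaining [2 h ^ 2 m n] is at most
   [(d + eps') n ^ 2 <= 2 eta h ^ 2 n ^ 2]. *)
have key : (m * n) * eps ^+ 2 <= (eta * n ^+ 2) * eps ^+ 2.
  move: upper lower many t1 t2 t3; rewrite XE.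
  have -> : eps = 2 * h by rewrite /h; lra.
  have -> : eps' = eta * h ^+ 2 by rewrite /eps' /h; field.
  move: (\sum_u \sum_v _) (\sum_u _) (h) (m) (n) (lam) (d); clear.
  by move=> h m n lam d A B; lra.
move: key; rewrite ler_pM2r // expr2 mulrA ler_pM2r //.
Qed.

(** * Counting transitive tournaments around a double clique *)

Section CliqueCounts.
Local Open Scope nat_scope.

Definition adj (V : Type) (e : rel V) : rel V := fun u v => e u v || e v u.

Lemma sum_perm_tuple (V : finType) (k : nat) (s : 'S_k) (F : k.-tuple V -> nat) :
  \sum_p F [tuple tnth p (s i) | i < k] = \sum_p F p.
Proof.
rewrite [RHS](reindex (fun p : k.-tuple V => [tuple tnth p (s i) | i < k])) //.
apply: onW_bij; exists (fun p => [tuple tnth p ((s^-1)%g i) | i < k]) => p;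
  by apply: eq_from_tnth => i; rewrite !tnth_mktuple ?permK ?permKV.
Qed.

(** Each counted tuple becomes a transitive tournament under one of the [k!] reorderings, and every
    reordering permutes the tuples. *)
Lemma orderable_tnum (V : finType) (e : rel V) (k : nat) :
  (\sum_(p : k.-tuple V) [exists q : k.-tuple V, perm_eq p q && pairwise e q]
     <= k`! * tnum e k)%N.
Proof.
apply: (@leq_trans (\sum_(s : 'S_k) \sum_(p : k.-tuple V)
    pairwise e [tuple tnth p (s i) | i < k])); last first.
  rewrite (eq_bigr (fun _ => tnum e k)) ?sum_nat_const ?card_Sn // => s _.
  exact: (sum_perm_tuple s (fun p => pairwise e p : nat)).
rewrite exchange_big /=; apply: leq_sum => p _.
case: existsP => // -[q /andP[]]; rewrite perm_sym => /tuple_permP[s E] pq.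
by rewrite (bigD1 s) //= -E pq.
Qed.

Section Swap.
Variables (V : finType) (r : nat).
Implicit Types (K : r.-tuple V) (i : 'I_r).

Definition upd K i (u : V) : r.-tuple V := [tuple if j == i then u else tnth K j | j < r].

Lemma tnth_upd K i u j : tnth (upd K i u) j = if j == i then u else tnth K j.
Proof. by rewrite tnth_mktuple. Qed.

(** Exchanging the [i]-th entry of [K] with the extra vertex [u] is an involution on the pairs
    [(K, u)]. *)
Lemma sum_upd i (F : r.-tuple V -> V -> nat) :
  \sum_K \sum_u F (upd K i u) (tnth K i) = \sum_K \sum_u F K u.
Proof.
rewrite !pair_bigA /= [RHS](reindex (fun x : r.-tuple V * V => (upd x.1 i x.2, tnth x.1 i))) //.
apply: onW_bij; exists (fun x : r.-tuple V * V => (upd x.1 i x.2, tnth x.1 i));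
  by case=> K u /=; rewrite tnth_upd eqxx; congr (_, _); apply: eq_from_tnth => j;
    rewrite !tnth_upd; case: eqP => // ->.
Qed.

Lemma sum_meets (S : {set V}) :
  (#|V| * \sum_(K : r.-tuple V) [exists i, tnth K i \in S] <= r * #|S| * #|V| ^ r)%N.
Proof.
apply: (@leq_trans (\sum_(i < r) \sum_(K : r.-tuple V) \sum_(u : V) (tnth K i \in S))).
  rewrite exchange_big /= big_distrr /=; apply: leq_sum => K _.
  case: existsP => [[i iS]|_]; last by rewrite muln0.
  by rewrite (bigD1 i) //= iS sum_nat_const muln1 leq_addr.
rewrite (eq_bigr (fun _ : 'I_r => #|S| * #|V| ^ r)%N) ?sum_nat_const ?card_ord ?mulnA //.
move=> i _; rewrite (sum_upd i (fun _ u => u \in S)) sum_nat_const card_tuple mulnC.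
by congr (_ * _)%N; rewrite -sum1_card [RHS]big_mkcond; apply: eq_bigr => u _; case: (u \in S).
Qed.

Variable e : rel V.

Definition dclique K := [forall i, forall j, (i != j) ==> bidir e (tnth K i) (tnth K j)].

Lemma bidirC u v : bidir e u v = bidir e v u.
Proof. by rewrite /bidir andbC. Qed.

Lemma dcliqueP K :
  reflect (forall i j, i != j -> bidir e (tnth K i) (tnth K j)) (dclique K).
Proof.
by apply: (iffP forallP) => [H i j|H i]; [move/implyP: (forallP (H i) j)|
  apply/forallP => j; apply/implyP; exact: H].
Qed.

Lemma pairwise_bidirE K : pairwise (bidir e) K = dclique K.
Proof.
apply/idP/dcliqueP => [|H].
  case: (posnP r) => [r0 _ i|r0]; first by have := leq_ltn_trans (leq0n i) (ltn_ord i); lia.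
  have v0 := tnth K (Ordinal r0); move/(pairwiseP v0) => H i j ne.
  wlog lt_ij : i j ne / (i < j)%N.
    move=> W; case: (ltngtP i j) => [||/val_inj E]; first exact: W.
      by rewrite bidirC; apply: W; rewrite eq_sym.
    by rewrite E eqxx in ne.
  by rewrite !(tnth_nth v0); apply: H; rewrite ?inE ?size_tuple.
case: (posnP r) => [r0|r0].
  by have /size0nil -> : size K = 0 by rewrite size_tuple.
have v0 := tnth K (Ordinal r0); apply/(pairwiseP v0) => i j; rewrite !inE size_tuple => ir jr ij.
have := H (Ordinal ir) (Ordinal jr); rewrite !(tnth_nth v0); apply.
by rewrite neq_ltn ij.
Qed.

Definition common K := [set v | [forall i, adj e v (tnth K i)]].

(** For a double clique [K]: replacing the [i]-th entry by [u] gives a double clique again. *)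
Definition dlink K i u := [forall j, (j != i) ==> bidir e u (tnth K j)].

Definition class_arcs K i := \sum_u \sum_v [&& e u v, dlink K i u & dlink K i v].

(** A vertex [v] joined to all entries of a double clique fits into it: entries with an arc to [v]
    go before [v], the others after. Since the entries are doubly joined, any order among them will
    do. *)
Lemma sum_common : (\sum_K dclique K * #|common K| <= r.+1`! * tnum e r.+1)%N.
Proof.
apply: leq_trans (orderable_tnum e r.+1).
rewrite big_tupleS exchange_big /=; apply: leq_sum => K _.
case: (boolP (dclique K)) => // clK; rewrite mul1n -sum1_card big_mkcond /=.
apply: leq_sum => v _; rewrite inE; case: forallP => // adjv.
suff -> : [exists q : r.+1.-tuple V, perm_eq (v :: K) q && pairwise e q] by [].
pose K1 := [seq u <- K | e u v]; pose K2 := [seq u <- K | ~~ e u v].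
have pq : perm_eq (v :: K) (K1 ++ v :: K2).
  by rewrite perm_sym -cat1s perm_catCA /= perm_cons perm_filterC.
have sz : size (K1 ++ v :: K2) == r.+1 by rewrite -(perm_size pq) /= size_tuple.
apply/existsP; exists (Tuple sz); rewrite pq /=.
have pK : pairwise e K.
  rewrite -pairwise_bidirE in clK; apply: sub_pairwise clK => u w.
  by case/andP.
have bi u w : u \in K -> w \in K -> u != w -> bidir e u w.
  move=> /tnthP[i ->] /tnthP[j ->] ne; apply: (dcliqueP _ clK).
  by apply: contraNneq ne => ->.
rewrite pairwise_cat pairwise_cons !(subseq_pairwise (filter_subseq _ _) pK) /= andbT.
apply/andP; split.
  apply/allrelP => u w; rewrite mem_filter => /andP[euv uK].
  rewrite inE => /predU1P[->//|]; rewrite mem_filter => /andP[ewv wK].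
  have /andP[] // : bidir e u w.
  by apply: bi => //; apply: contraNneq ewv => <-.
apply/allP => u; rewrite mem_filter => /andP[ne /tnthP[i E]].
by have := adjv i; rewrite /adj -E (negPf ne) orbF.
Qed.

(** For an arc from [u] to [v] inside class [i], put [u] in place of the [i]-th entry: the new tuple
    is a double clique and [v] is joined to all of it. The replaced entry is forgotten, which costs
    the factor [#|V|]. *)
Lemma sum_class_arcs i :
  (\sum_K dclique K * class_arcs K i <= #|V| * \sum_K dclique K * #|common K|)%N.
Proof.
pose F K u := (dclique K * \sum_v [&& e u v, dlink K i u & dlink K i v])%N.
have -> : (\sum_K dclique K * class_arcs K i = \sum_K \sum_u F K u)%N.
  by apply: eq_bigr => K _; rewrite big_distrr.
rewrite -(sum_upd i) big_distrr /=; apply: leq_sum => K _.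
rewrite -sum_nat_const; apply: leq_sum => w _; rewrite /F.
case: dcliqueP => // clw; rewrite mul1n.
have dlE u : dlink (upd K i w) i u = dlink K i u.
  by apply: eq_forallb => j; rewrite tnth_upd; case: eqP.
under eq_bigr do rewrite !dlE.
case: (boolP (dlink K i (tnth K i))) => [dK|_]; last first.
  by rewrite big1 // => v _; rewrite andbF.
have -> : dclique K.
  apply/dcliqueP => j l; have [->|ji] := eqVneq j i.
    by move=> li; have /forallP/(_ l) := dK; rewrite eq_sym li.
  have [-> _|li jl] := eqVneq l i.
    by rewrite bidirC; have /forallP/(_ j) := dK; rewrite ji.
  by have := clw j l jl; rewrite !tnth_upd (negPf ji) (negPf li).
rewrite mul1n -sum1_card [leqRHS]big_mkcond /=; apply: leq_sum => v _.
case: andP => // -[ev /forallP dv]; rewrite inE.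
suff -> : [forall j, adj e v (tnth K j)] by [].
apply/forallP => j; have [->|ji] := eqVneq j i; first by rewrite /adj ev orbT.
by have := dv j; rewrite ji /adj /= => /andP[->].
Qed.

End Swap.

End CliqueCounts.

(** * The partition defined by a double clique *)

Section Partition.
Variables (R : realFieldType) (V : finType) (r : nat) (a : R) (e : rel V).
Hypotheses (a_gt : 3 / 2 < a) (a_le : a <= 2) (r_gt0 : (0 < r)%N).
Implicit Types (p : V -> 'I_r).

Definition psize p (i : 'I_r) : nat := #|[set v | p v == i]|.
Definition inner p : nat := (\sum_u \sum_v (e u v && (p u == p v)))%N.
Definition missing p : nat := (\sum_u \sum_v (~~ e u v && (p u != p v)))%N.
Definition pvar p : R := \sum_i ((psize p i)%:R - #|V|%:R / r%:R) ^+ 2.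

Lemma sum_psize p : (\sum_i psize p i = #|V|)%N.
Proof.
rewrite -sum1_card (partition_big p predT) //=; apply: eq_bigr => i _.
by rewrite /psize -sum1_card; apply: eq_bigl => v; rewrite inE.
Qed.

Lemma sum_same_part p :
  \sum_u \sum_v (p u == p v)%:R = #|V|%:R ^+ 2 / r%:R + pvar p.
Proof.
have -> : \sum_u \sum_v (p u == p v)%:R = \sum_i (psize p i)%:R ^+ 2 :> R.
  rewrite (partition_big p predT) //=; apply: eq_bigr => i _.
  rewrite (eq_bigr (fun _ => (psize p i)%:R)) => [|u /eqP <-].
    by rewrite sumr_const -[LHS]mulr_natl expr2 /psize; congr (_%:R * _); apply: eq_card => u;
      rewrite inE.
  rewrite /psize -sum1_card natr_sum [RHS]big_mkcond; apply: eq_bigr => v _.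
  by rewrite inE eq_sym; case: eqP.
have rn : r%:R != 0 :> R by rewrite pnatr_eq0 -lt0n.
have := sum_psize p => /(congr1 (fun k : nat => k%:R : R)); rewrite natr_sum => S.
have -> : pvar p = \sum_i ((psize p i)%:R ^+ 2 - 2 * #|V|%:R / r%:R * (psize p i)%:R
    + (#|V|%:R / r%:R) ^+ 2) by apply: eq_bigr => i _; ring.
rewrite big_split sumrB -mulr_sumr S sumr_const card_ord /= -[_ *+ r]mulr_natl.
by field.
Qed.

(** Pair by pair: across classes the weight is at most [a] minus [(a - 1) / 2] for each missing arc,
    inside a class at most [a] for each arc. Every arc is seen from both orders of its ends, which
    doubles the coefficients. *)
Lemma sum_deg_partition p :
  \sum_u deg a e u <= a * (#|V|%:R ^+ 2 * (1 - r%:R^-1) - pvar p)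
    - (a - 1) * (missing p)%:R + 2 * a * (inner p)%:R.
Proof.
have -> : (missing p)%:R = \sum_u \sum_v (~~ e u v && (p u != p v))%:R :> R.
  by rewrite natr_sum; apply: eq_bigr => u _; rewrite natr_sum.
have -> : (inner p)%:R = \sum_u \sum_v (e u v && (p u == p v))%:R :> R.
  by rewrite natr_sum; apply: eq_bigr => u _; rewrite natr_sum.
set M := \sum_u _; set I := \sum_u _.
have pt u v : wt a e u v <= a * (1 - (p u == p v)%:R)
    - (a - 1) / 2 * ((~~ e u v && (p u != p v))%:R + (~~ e v u && (p u != p v))%:R)
    + a * ((e u v && (p u == p v))%:R + (e v u && (p u == p v))%:R).
  by rewrite /wt /bidir; case: (p u == p v); case: (e u v); case: (e v u) => /=;
    move: a_gt a_le; lra.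
have M' : M = \sum_u \sum_v (~~ e v u && (p u != p v))%:R.
  by rewrite /M exchange_big; apply: eq_bigr => u _; apply: eq_bigr => v _; rewrite eq_sym.
have I' : I = \sum_u \sum_v (e v u && (p u == p v))%:R.
  by rewrite /I exchange_big; apply: eq_bigr => u _; apply: eq_bigr => v _; rewrite eq_sym.
have all1 : \sum_(u : V) \sum_(v : V) 1 = #|V|%:R ^+ 2 :> R.
  by rewrite !sumr_const -mulrnA natrM expr2.
have -> : a * (#|V|%:R ^+ 2 * (1 - r%:R^-1) - pvar p) - (a - 1) * M + 2 * a * I =
   a * (#|V|%:R ^+ 2 - (#|V|%:R ^+ 2 / r%:R + pvar p))
     - (a - 1) / 2 * (M + M) + a * (I + I) by field; rewrite pnatr_eq0 -lt0n.
rewrite -sum_same_part -all1 {2}M' {2}I' /M /I -!big_split -sumrB !mulr_sumr -sumrB -big_split.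
apply: ler_sum => u _.
rewrite -!big_split -sumrB !mulr_sumr -sumrB -big_split; apply: ler_sum => v _ /=.
exact: pt.
Qed.

Variable K : r.-tuple V.

Definition in_class i v := ~~ adj e v (tnth K i) && dlink e K i v.
Definition leftover := [set v | ~~ [exists i, in_class i v]].

(** A vertex outside [common e K] has weight 0 to some entry, a loss of [a]. If it is also in
    [leftover], another entry is not doubly joined to it, a further loss of at least [a - 1]. For
    common vertices, 3 covers [a + (a - 1)]. *)
Lemma sum_wt_clique v :
  \sum_i wt a e (tnth K i) v
    <= a * (r%:R - 1) - (a - 1) * (v \in leftover)%:R + 3 * (v \in common e K)%:R.
Proof.
have a1 : 1 <= a by move: a_gt; lra.
pose g i := a - wt a e (tnth K i) v.
have g0 i : 0 <= g i by rewrite subr_ge0 wt_le.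
have -> : \sum_i wt a e (tnth K i) v = a * r%:R - \sum_i g i.
  by rewrite sumrB sumr_const card_ord -[a *+ r]mulr_natr; ring.
suff : a + (a - 1) * (v \in leftover)%:R - 3 * (v \in common e K)%:R <= \sum_i g i by lra.
case: (boolP (v \in common e K)) => [_|].
  have : 0 <= \sum_i g i by apply: sumr_ge0.
  by case: (v \in leftover) => /=; move: a_le; lra.
rewrite inE => /forallPn[i nadj].
have gi : g i = a.
  move: nadj; rewrite /g /wt /bidir /adj orbC andbC.
  by case: (e v _); case: (e _ v) => //= _; rewrite subr0.
rewrite (bigD1 i) //= gi; case: (boolP (v \in leftover)) => [|_]; last first.
  by have : 0 <= \sum_(j < r | j != i) g j by [apply: sumr_ge0]; rewrite /=; lra.
rewrite inE => /existsPn/(_ i); rewrite /in_class nadj => /forallPn[j].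
rewrite negb_imply => /andP[ji nb]; rewrite (bigD1 j) //=.
have : a - 1 <= g j.
  move: nb; rewrite /g /wt bidirC => /negPf ->.
  by case: (_ || _) => /=; move: a_gt; lra.
by have : 0 <= \sum_(l < r | (l != i) && (l != j)) g l by [apply: sumr_ge0]; rewrite /=; lra.
Qed.

(** Double counting of the weight between [K] and all vertices: the degrees of the entries bound it
    from below, [sum_wt_clique] from above. Dividing by [a - 1 >= 1/2] doubles the constants. *)
Lemma card_leftover (eps : R) :
    (forall i, (a * (1 - r%:R^-1) - eps) * #|V|%:R <= deg a e (tnth K i)) ->
  #|leftover|%:R <= 2 * r%:R * eps * #|V|%:R + 6 * #|common e K|%:R.
Proof.
move=> degK.
have card_sum (S : {set V}) : #|S|%:R = \sum_v (v \in S)%:R :> R.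
  by rewrite -natr_sum -sum1_card big_mkcond; congr _%:R; apply: eq_bigr => v _; case: (v \in S).
have upper : \sum_i deg a e (tnth K i) <=
    a * (r%:R - 1) * #|V|%:R - (a - 1) * #|leftover|%:R + 3 * #|common e K|%:R.
  rewrite exchange_big !card_sum -[#|V|%:R]/(1 *+ #|V|) -sumr_const !mulr_sumr.
  rewrite -sumrB -big_split; apply: ler_sum => v _.
  by apply: le_trans (sum_wt_clique v) _; rewrite mulr1.
have lower : a * (r%:R - 1) * #|V|%:R - r%:R * eps * #|V|%:R <= \sum_i deg a e (tnth K i).
  have -> : a * (r%:R - 1) * #|V|%:R - r%:R * eps * #|V|%:R
      = \sum_(i < r) (a * (1 - r%:R^-1) - eps) * #|V|%:R.
    rewrite sumr_const card_ord -[RHS]mulr_natl; field.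
    by rewrite pnatr_eq0 -lt0n.
  by apply: ler_sum => i _.
have : (2^-1) * #|leftover|%:R <= (a - 1) * #|leftover|%:R.
  by apply: ler_wpM2r => //; move: a_gt; lra.
lra.
Qed.

(** Vertices of [leftover] are put into class 0; arcs at them are bounded by the size of
    [leftover]. *)
Definition class_of (v : V) : 'I_r := odflt (Ordinal r_gt0) [pick i | in_class i v].

Lemma inner_class_of :
  (inner class_of <= \sum_i class_arcs e K i + 2 * (#|leftover| * #|V|))%N.
Proof.
have classP v : v \notin leftover -> dlink e K (class_of v) v.
  rewrite inE negbK => /existsP[i iv]; rewrite /class_of.
  by case: pickP => [j /andP[]//|/(_ i)]; rewrite iv.
have left1 : (\sum_(u : V) \sum_(v : V) (u \in leftover) = #|leftover| * #|V|)%N.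
  rewrite exchange_big sum_nat_const mulnC; congr (_ * _)%N.
  by rewrite -sum1_card [RHS]big_mkcond; apply: eq_bigr => u _; case: (u \in leftover).
have left2 : (\sum_(u : V) \sum_(v : V) (v \in leftover) = #|leftover| * #|V|)%N.
  by rewrite -left1 exchange_big.
have arcsE : (\sum_i class_arcs e K i
    = \sum_u \sum_v \sum_i [&& e u v, dlink e K i u & dlink e K i v])%N.
  by rewrite exchange_big /=; apply: eq_bigr => u _; rewrite exchange_big.
rewrite mul2n -addnn -{1}left1 -left2 arcsE -!big_split /=.
apply: leq_sum => u _; rewrite -!big_split /=; apply: leq_sum => v _.
case: (boolP (u \in leftover)) => [_|/classP cu]; first by case: (_ && _) => //; lia.
case: (boolP (v \in leftover)) => [_|/classP cv]; first by case: (_ && _) => //; lia.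
case: eqP => [E|]; rewrite ?andbF // andbT.
by rewrite -E in cv; rewrite (bigD1 (class_of u)) //= cu cv !andbT; lia.
Qed.

(** At most [13 rho + 4 r eps] times [n ^ 2] arcs lie inside classes, and [kap] is [gam] plus four
    times that, as [2 a <= 4]. Comparing the degree sum with [sum_deg_partition] bounds
    [a pvar + (a - 1) missing] by [kap n ^ 2]; then [missing <= 2 kap n ^ 2] by [a - 1 >= 1/2]. *)
Lemma clique_partition (eps rho gam : R) :
    0 <= eps -> 0 <= rho -> 0 <= gam ->
    (forall i, (a * (1 - r%:R^-1) - eps) * #|V|%:R <= deg a e (tnth K i)) ->
    (#|common e K| * #|V| + \sum_i class_arcs e K i)%:R <= rho * #|V|%:R ^+ 2 ->
    (a * (1 - r%:R^-1) - gam) * #|V|%:R ^+ 2 <= \sum_u deg a e u ->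
  let kap := gam + 52 * rho + 16 * r%:R * eps in
  (inner class_of + missing class_of)%:R <= 3 * kap * #|V|%:R ^+ 2
    /\ pvar class_of <= kap * #|V|%:R ^+ 2.
Proof.
move=> eps0 rho0 gam0 degK few many kap.
have := sum_deg_partition class_of.
have In_le : (inner class_of)%:R <= (13 * rho + 4 * r%:R * eps) * #|V|%:R ^+ 2 :> R.
  have := inner_class_of; rewrite -(ler_nat R) natrD !natrM => /le_trans; apply.
  have := ler_wpM2r (ler0n R #|V|) (card_leftover degK).
  move: few; rewrite natrD natrM expr2.
  have : 0 <= (\sum_i class_arcs e K i)%:R :> R by [].
  have : 0 <= #|common e K|%:R * #|V|%:R :> R by rewrite mulr_ge0.
  move: ((\sum_i _)%:R : R) (#|common _ _|%:R : R) (#|V|%:R : R) (#|leftover|%:R : R) (r%:R : R).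
  by move=> S c n l q; lra.
have M0 : 0 <= (missing class_of)%:R :> R by [].
have I0 : 0 <= (inner class_of)%:R :> R by [].
have v0 : 0 <= pvar class_of by apply: sumr_ge0 => i _; exact: sqr_ge0.
have n0 := sqr_ge0 (#|V|%:R : R).
have av : pvar class_of <= a * pvar class_of.
  by rewrite -[leLHS]mul1r; apply: ler_wpM2r => //; move: a_gt; lra.
have am : 2^-1 * (missing class_of)%:R <= (a - 1) * (missing class_of)%:R.
  by apply: ler_wpM2r => //; move: a_gt; lra.
have ai : a * (inner class_of)%:R <= 2 * (inner class_of)%:R by apply: ler_wpM2r.
rewrite natrD; move: many In_le M0 I0 v0 n0 av am ai; rewrite /kap.
have : 0 <= gam * #|V|%:R ^+ 2 by rewrite mulr_ge0 ?sqr_ge0.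
have : 0 <= rho * #|V|%:R ^+ 2 by rewrite mulr_ge0 ?sqr_ge0.
have : 0 <= r%:R * eps * #|V|%:R ^+ 2 by rewrite !mulr_ge0 ?sqr_ge0.
move: (\sum_u _) ((inner _)%:R : R) ((missing _)%:R : R) (pvar _) (#|V|%:R ^+ 2 : R).
move: (r%:R^-1 : R) (r%:R : R).
by move=> ir q W In Ms Var n *; split; move: a_gt a_le; lra.
Qed.

End Partition.

(** * Matching the partition with the Turan graph *)

(* A permutation maximizing the agreement works: if [u] disagrees and some [w] with
   [q (s w) = p u] does not belong to the class of [u], exchanging [u] and [w] gains. *)
Lemma perm_matching (V : finType) (r : nat) (p q : V -> 'I_r) :
  exists s : {perm V}, (#|[set v | q (s v) != p v]| <= \sum_j (psize p j - psize q j))%N.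
Proof.
pose agree (s : {perm V}) := [set v | q (s v) == p v].
have [s _ smax] := @arg_maxnP _ 1%g xpredT (fun s : {perm V} => #|agree s|) isT.
exists s.
have agrees u w : q (s u) != p u -> q (s w) = p u -> p w = p u.
  move=> du qw; apply/eqP; apply: contraT => ne.
  have uw : u != w by apply: contraNneq ne => ->.
  have : (#|agree (tperm u w * s)%g| <= #|agree s|)%N := smax _ isT.
  rewrite leqNgt => /negP[].
  apply: (@leq_trans #|u |: agree s|); first by rewrite cardsU1 inE du.
  apply/subset_leq_card/subsetP => x; rewrite !inE permM.
  case/predU1P=> [->|]; first by rewrite tpermL qw.
  case: tpermP => [->|->|//]; first by rewrite (negPf du).
  by rewrite qw eq_sym (negPf ne).
have -> : #|[set v | q (s v) != p v]| =
    (\sum_j #|[set v | (p v == j) && (q (s v) != j)]|)%N.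
  rewrite -sum1_card (partition_big p predT) //=; apply: eq_bigr => j _.
  rewrite -sum1_card; apply: eq_bigl => v; rewrite !inE andbC.
  by case: eqP => // ->.
apply: leq_sum => j _.
have [->|/set0Pn[u]] := eqVneq [set v | (p v == j) && (q (s v) != j)] set0.
  by rewrite cards0.
rewrite inE => /andP[/eqP pu]; rewrite -pu => du.
(* Once a vertex of this class disagrees, the preimage of the whole [q]-class lies inside the
   [p]-class, so the disagreeing vertices form their difference. *)
have sub : s @^-1: [set w | q w == p u] \subset [set v | p v == p u].
  by apply/subsetP => w; rewrite !inE => /eqP/(agrees _ _ du) ->.
have -> : psize q (p u) = #|s @^-1: [set w | q w == p u]|.
  by rewrite card_preimset //; exact: perm_inj.
rewrite /psize -(setIidPr sub) -cardsD; apply/subset_leq_card/subsetP => v.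
by rewrite !inE andbC.
Qed.

Lemma card_rel (V : finType) (h : rel V) :
  #|[set x : V * V | h x.1 x.2]| = (\sum_u \sum_v h u v)%N.
Proof.
rewrite pair_bigA /= -sum1_card big_mkcond; apply: eq_bigr => x _.
by rewrite inE; case: (h _ _).
Qed.

Lemma double_count (n : nat) (h : rel 'I_n) :
    (forall u v, h u v = h v u) -> (forall v, h v v = false) ->
  (\sum_u \sum_v h u v = 2 * #|[set p : 'I_n * 'I_n | (p.1 < p.2)%N && h p.1 p.2]|)%N.
Proof.
move=> hC hirr.
rewrite (card_rel (fun u v : 'I_n => (u < v)%N && h u v)).
rewrite mul2n -addnn [X in (_ + X)%N]exchange_big -big_split; apply: eq_bigr => u _.
rewrite -big_split; apply: eq_bigr => v _ /=; rewrite [h v u]hC.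
by case: (ltngtP u v) => [||/val_inj ->]; rewrite ?addn0 ?hirr.
Qed.

Lemma sum_deg_e_a (R : realType) (a : R) (n : nat) (G : rel 'I_n) :
  loopless G -> \sum_u deg a G u = 2 * e_a a G.
Proof.
move=> loopG; have irr v : G v v = false by apply: negbTE.
have := @double_count n (fun u v => G u v != G v u).
have := @double_count n (bidir G).
rewrite -/(f1 G) -[X in (2 * X)%N]/(f2 G) => E2 E1.
have -> : 2 * e_a a G = a * (2 * f2 G)%N%:R + (2 * f1 G)%N%:R.
  by rewrite /e_a !natrM; ring.
rewrite -E1; last 2 first.
- by move=> u v; rewrite eq_sym.
- by move=> v; rewrite eqxx.
rewrite -E2; last 2 first.
- by move=> u v; rewrite /bidir andbC.
- by move=> v; rewrite /bidir irr.
rewrite !natr_sum mulr_sumr -big_split; apply: eq_bigr => u _.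
rewrite !natr_sum mulr_sumr -big_split; apply: eq_bigr => v _.
by rewrite /wt /bidir; case: (G u v); case: (G v u); rewrite /= ?mulr1 ?mulr0 ?addr0 ?add0r.
Qed.

Definition residue (r n : nat) (r0 : (0 < r)%N) (v : 'I_n) : 'I_r :=
  Ordinal (ltn_pmod v r0).

Lemma psize_residue_ge (R : realFieldType) (r n : nat) (r0 : (0 < r)%N) (j : 'I_r) :
  n%:R / r%:R - 1 <= (psize (@residue r n r0) j)%:R :> R.
Proof.
have le : (n %/ r <= psize (@residue r n r0) j)%N.
  have lt (k : 'I_(n %/ r)) : (k * r + j < n)%N.
    apply: (@leq_trans (k.+1 * r)); first by rewrite mulSn addnC ltn_add2r.
    by apply: leq_trans (leq_divM n r); rewrite leq_mul2r ltn_ord orbT.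
  rewrite -[leqLHS]card_ord -(card_imset predT (f := fun k => Ordinal (lt k))).
    apply/subset_leq_card/subsetP => _ /imsetP[k _ ->]; rewrite inE.
    by apply/eqP/val_inj; rewrite /= modnMDl modn_small.
  by move=> k l /(congr1 val) /= /addIn/eqP; rewrite eqn_pmul2r // => /eqP/val_inj.
rewrite lerBlDr; apply: (@le_trans _ _ (n %/ r).+1%:R).
  by rewrite ler_pdivrMr ?ltr0n // -natrM ler_nat ltnW // ltn_ceil.
by rewrite natr1 ler_nat ltnS.
Qed.

(** Since all other classes have at least [n / r - 1] vertices, none has more than [n / r + r]. So
    each deviation is at most [r] in absolute value. *)
Lemma pvar_residue_le (R : realFieldType) (r n : nat) (r0 : (0 < r)%N) :
  pvar R (@residue r n r0) <= r%:R ^+ 3.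
Proof.
have lower j := psize_residue_ge R n r0 j.
have upper j : (psize (@residue r n r0) j)%:R <= n%:R / r%:R + r%:R :> R.
  have := sum_psize (@residue r n r0); rewrite card_ord => /(congr1 (fun k : nat => k%:R : R)).
  rewrite natr_sum (bigD1 j) //= => E.
  have : \sum_(i < r | i != j) (n%:R / r%:R - 1) <=
      \sum_(i < r | i != j) (psize (@residue r n r0) i)%:R :> R by apply: ler_sum.
  rewrite sumr_const; have := cardC1 j; rewrite card_ord => -> H.
  have E2 : (n%:R / r%:R - 1) *+ r.-1 = n%:R - n%:R / r%:R - r%:R + 1 :> R.
    rewrite -subn1 -[LHS]mulr_natl natrB //; field.
    by rewrite pnatr_eq0 -lt0n.
  move: H; rewrite E2; lra.
have -> : r%:R ^+ 3 = \sum_(j < r) r%:R ^+ 2 :> R.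
  by rewrite sumr_const card_ord -[RHS]mulr_natl -exprS.
rewrite /pvar card_ord; apply: ler_sum => j _.
have r1 : 1 <= r%:R :> R by rewrite ler1n.
set d := _ - _; have dr : 0 <= r%:R - d by have := upper j; rewrite /d; lra.
have rd : 0 <= r%:R + d by have := lower j; rewrite /d; lra.
have := mulr_ge0 dr rd; lra.
Qed.

Lemma turan_num_ge (R : realFieldType) (r n : nat) : (0 < r)%N ->
  n%:R ^+ 2 * (1 - r%:R^-1) - r%:R ^+ 3 <= 2 * (turan_num r n)%:R :> R.
Proof.
move=> r0; pose q := @residue r n r0.
have qE u v : turan_adj r u v = (q u != q v) by [].
have <- : \sum_u \sum_v (q u != q v)%:R = 2 * (turan_num r n)%:R :> R.
  rewrite -natrM /turan_num -double_count.
  - by rewrite natr_sum; apply: eq_bigr => u _; rewrite natr_sum.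
  - by move=> u v; rewrite !qE eq_sym.
  - by move=> v; rewrite qE eqxx.
have E : \sum_u \sum_v (q u != q v)%:R = n%:R ^+ 2 - \sum_u \sum_v (q u == q v)%:R :> R.
  have <- : \sum_(u < n) \sum_(v < n) 1 = n%:R ^+ 2 :> R.
    by rewrite !sumr_const card_ord -mulrnA natrM expr2.
  rewrite -sumrB; apply: eq_bigr => u _; rewrite -sumrB; apply: eq_bigr => v _.
  by case: eqP; rewrite ?subrr ?subr0.
rewrite E sum_same_part // card_ord; have := pvar_residue_le R n r0; lra.
Qed.

(** * Choice of the double clique and final estimates *)

Lemma select_clique (R : realFieldType) (V : finType) (e : rel V) (r : nat)
    (S : {set V}) (d rho : R) :
    (0 < #|V|)%N -> 0 < d -> 0 < rho ->
    d * #|V|%:R ^+ r < (tnum (bidir e) r)%:R ->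
    r%:R * #|S|%:R <= d / 2 * #|V|%:R ->
    4 * (r.+1%:R * r.+1`!%:R) * (tnum e r.+1)%:R <= rho * d * #|V|%:R ^+ r.+1 ->
  exists K : r.-tuple V, [/\ dclique e K, forall i, tnth K i \notin S &
    (#|common e K| * #|V| + \sum_i class_arcs e K i)%:R <= rho * #|V|%:R ^+ 2].
Proof.
set n : R := #|V|%:R => V0 d0 rho0 many fewS fewT.
have n0 : 0 < n by rewrite ltr0n.
pose val (K : r.-tuple V) := (#|common e K| * #|V| + \sum_i class_arcs e K i)%N.
pose meets (K : r.-tuple V) := [exists i, tnth K i \in S].
have meets_le : (\sum_(K : r.-tuple V) meets K)%:R <= d / 2 * n ^+ r.
  have := sum_meets r S; rewrite -(ler_nat R) !natrM natrX -/n => le.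
  rewrite -(ler_pM2l n0); apply: (le_trans le).
  rewrite mulrA [n * _]mulrC ler_wpM2r //.
  by rewrite exprn_ge0 // ltW.
have total : (\sum_(K : r.-tuple V) dclique e K * val K)%:R <= rho * d / 4 * n ^+ r.+2.
  have le : (\sum_(K : r.-tuple V) dclique e K * val K <= r.+1 * r.+1`! * tnum e r.+1 * #|V|)%N.
    have -> : (\sum_(K : r.-tuple V) dclique e K * val K =
        #|V| * (\sum_(K : r.-tuple V) dclique e K * #|common e K|)
        + \sum_i \sum_(K : r.-tuple V) dclique e K * class_arcs e K i)%N.
      rewrite [in RHS]exchange_big big_distrr -big_split /=; apply: eq_bigr => K _.
      by rewrite /val mulnDr big_distrr /=; congr (_ + _)%N; rewrite mulnA mulnC.
    have le2 := leq_mul (leqnn #|V|) (sum_common r e).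
    (* [r.+1] equal bounds: one for the common neighbours and one for the arcs in each of the [r]
       classes. *)
    apply: (@leq_trans (\sum_(i < r.+1) #|V| * (r.+1`! * tnum e r.+1))); last first.
      by rewrite sum_nat_const card_ord; lia.
    rewrite big_ord_recl; apply: leq_add => //; apply: leq_sum => i _.
    exact: leq_trans (sum_class_arcs _ _) le2.
  move: le fewT; move: r.+1`! => F le fewT.
  rewrite -(ler_nat R) !natrM -/n in le; apply: (le_trans le).
  have := ler_wpM2r (ltW n0) fewT; rewrite [n ^+ r.+2]exprSr.
  by move: ((tnum e _)%:R : R) (F%:R : R) (r.+1%:R : R) (n ^+ r.+1) => A B C D; lra.
suff [K /andP[clK avoid] le] : exists2 K, dclique e K && ~~ meets K &
    (val K)%:R <= rho * n ^+ 2.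
  by exists K; split=> //; move: avoid; rewrite negb_exists => /forallP.
(* If every double clique avoiding [S] had value above [rho n ^ 2], there would be at most
   [(d / 2 + d / 4) n ^ r] double cliques, by [meets_le] and [total]. *)
apply/exists_inP; apply: contraT; rewrite negb_exists_in => /forall_inP large.
have : (\sum_(K : r.-tuple V) dclique e K)%:R * (rho * n ^+ 2) <=
    (\sum_(K : r.-tuple V) meets K)%:R * (rho * n ^+ 2)
      + (\sum_(K : r.-tuple V) dclique e K * val K)%:R.
  rewrite !natr_sum !mulr_suml -big_split; apply: ler_sum => K _ /=.
  have rn : 0 <= rho * n ^+ 2 by rewrite mulr_ge0 ?sqr_ge0 // ltW.
  have := large K; case: (dclique e K); case: (meets K) => /= H;
    rewrite ?mul0r ?mul1r ?mul1n ?mul0n ?add0r ?addr0 ?lerDl //.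
  by have := H isT; rewrite -ltNge => /ltW.
have -> : (\sum_(K : r.-tuple V) dclique e K = tnum (bidir e) r)%N.
  by apply: eq_bigr => K _; rewrite pairwise_bidirE.
have rn : 0 < rho * n ^+ 2 by rewrite mulr_gt0 // exprn_gt0.
have := ler_wpM2r (ltW rn) meets_le.
have := many; rewrite -(ltr_pM2r rn); move: total; rewrite -[r.+2]addn2 exprD.
have : 0 < rho * d * (n ^+ r * n ^+ 2) by rewrite !mulr_gt0 ?exprn_gt0.
move: ((\sum_(K : r.-tuple V) _)%:R : R) ((\sum_(K : r.-tuple V) _)%:R : R).
move: ((tnum _ _)%:R : R) (n ^+ r) (n ^+ 2); clear => A B C D E; lra.
Qed.

(** Between two vertices whose residue class agrees with [p], a differing arc is either inside a
    class or missing between classes. All other pairs are charged to a disagreeing end. *)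
Lemma arc_dist_le (n r : nat) (r0 : (0 < r)%N) (G : rel 'I_n) (p : 'I_n -> 'I_r)
    (s : {perm 'I_n}) :
  (arc_dist G (DT_copy r s) <= inner G p + missing G p
     + 2 * (#|[set v | residue r0 (s v) != p v]| * n))%N.
Proof.
set D := [set v | _].
have left1 : (\sum_(u < n) \sum_(v < n) (u \in D) = #|D| * n)%N.
  rewrite exchange_big sum_nat_const card_ord mulnC; congr (_ * _)%N.
  by rewrite -sum1_card [RHS]big_mkcond; apply: eq_bigr => u _; case: (u \in D).
have left2 : (\sum_(u < n) \sum_(v < n) (v \in D) = #|D| * n)%N.
  by rewrite -left1 exchange_big.
rewrite /arc_dist (card_rel (fun u v => (u != v) && (G u v != DT_copy r s u v))).
rewrite mul2n -addnn -{1}left1 -left2 -!big_split /=.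
apply: leq_sum => u _; rewrite -!big_split /=; apply: leq_sum => v _.
have -> : DT_copy r s u v = (residue r0 (s u) != residue r0 (s v)) by [].
case: (boolP (u \in D)) => [_|]; first by case: (_ && _) => //; lia.
case: (boolP (v \in D)) => [_|]; first by case: (_ && _) => //; lia.
rewrite !inE !negbK => /eqP -> /eqP ->.
by case: (u != v); case: (G u v); case: (p u == p v).
Qed.

(** A single square is at most the whole [pvar], so no class exceeds [n / r] by more than [xi n],
    while a residue class falls short of it by at most 1. *)
Lemma misfit_le (R : realFieldType) (n r : nat) (r0 : (0 < r)%N) (p : 'I_n -> 'I_r) (xi : R) :
    0 <= xi -> pvar R p <= xi ^+ 2 * n%:R ^+ 2 ->
  (\sum_j (psize p j - psize (@residue r n r0) j))%:R <= r%:R * (xi * n%:R + 1) :> R.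
Proof.
move=> xi0 var.
have -> : r%:R * (xi * n%:R + 1) = \sum_(j < r) (xi * n%:R + 1).
  by rewrite sumr_const card_ord -[RHS]mulr_natl.
rewrite natr_sum; apply: ler_sum => j _.
have xn : 0 <= xi * n%:R by rewrite mulr_ge0.
have := leqVgt (psize p j) (psize (@residue r n r0) j); case/orP => [le|lt].
  by rewrite (eqP (le : _ - _ == 0)%N) addr_ge0.
rewrite natrB; last exact: ltnW.
have low := psize_residue_ge R n r0 j.
have : (psize p j)%:R - n%:R / r%:R <= xi * n%:R.
  rewrite leNgt; apply/negP => big.
  have : (xi * n%:R) ^+ 2 < ((psize p j)%:R - n%:R / r%:R) ^+ 2.
    by rewrite ltrXn2r // ?nnegrE // ltW // (le_lt_trans xn big).
  rewrite ltNge => /negP; apply; rewrite exprMn; apply: le_trans var.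
  rewrite /pvar card_ord (bigD1 j) //= lerDl.
  by apply: sumr_ge0 => i _; exact: sqr_ge0.
lra.
Qed.

Lemma eventually_sqr_ge (R : realType) (c C : R) : 0 < c ->
  exists n0 : nat, forall n, (n0 <= n)%N -> (0 < n)%N /\ C * n%:R <= c * n%:R ^+ 2.
Proof.
move=> c0; pose z := `|C| / c.
have z0 : 0 <= z by rewrite divr_ge0 // ltW.
exists (Num.Def.archi_bound z).+1 => n lt_n; split; first exact: leq_ltn_trans lt_n.
have zn : z <= n%:R.
  by apply: le_trans (ltW (archi_boundP z0)) _; rewrite ler_nat ltnW.
rewrite expr2 mulrA ler_wpM2r //; apply: le_trans (ler_norm C) _.
by rewrite mulrC -ler_pdivrMr.
Qed.

Theorem theorem4p1 (R : realType) (r t : nat) (a : R) :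
  (2 <= r)%N -> (1 <= t)%N -> 3 / 2 < a -> a <= 2 ->
  forall beta : R, 0 < beta ->
  exists gamma : R, 0 < gamma /\
  exists n0 : nat, forall n : nat, (n0 <= n)%N ->
  forall G : rel 'I_n, loopless G -> blowup_free r t G ->
    e_a a G >= a * (turan_num r n)%:R - gamma * (n%:R ^+ 2) ->
    exists s : {perm 'I_n}, (arc_dist G (DT_copy r s))%:R <= beta * (n%:R ^+ 2).
Proof.
move=> r2 _ a32 a2 beta beta0.
have r0 : (0 < r)%N by exact: ltnW.
have rR : 0 < r%:R :> R by rewrite ltr0n.
have rN : r%:R != 0 :> R by rewrite lt0r_neq0.
have [d0 d00 Hmany] := many_bidir_cliques a32 r2.
(* The budget [beta] is spent as follows: [3 kap <= beta / 4] on arcs inside classes and missing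
   between them, [2 r xi = beta / 4] on the disagreeing vertices, and [beta / 2] on the lower-order
   term [2 r n]. *)
pose xi : R := beta / (8 * r%:R).
have xi0 : 0 < xi by rewrite divr_gt0 // mulr_gt0.
pose kap := Num.min (xi ^+ 2) (beta / 12).
have kap0 : 0 < kap by rewrite lt_min exprn_gt0 //= divr_gt0.
have kap_xi : kap <= xi ^+ 2 by rewrite ge_min lexx.
have kap_beta : kap <= beta / 12 by rewrite ge_min lexx orbT.
(* Each of [gam], [52 rho] and [16 r eps] is allotted a quarter of [kap]. *)
pose eps := Num.min 1 (kap / (64 * r%:R)).
have eps0 : 0 < eps by rewrite lt_min ltr01 divr_gt0 // mulr_gt0.
have eps1 : eps <= 1 by rewrite ge_min lexx.
have eps_kap : 16 * r%:R * eps <= kap / 4.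
  have -> : kap / 4 = 16 * r%:R * (kap / (64 * r%:R)) by field.
  by apply: ler_wpM2l; [rewrite mulr_ge0|rewrite ge_min lexx orbT].
pose rho := kap / 208.
have rho0 : 0 < rho by rewrite divr_gt0.
pose eta := d0 / (2 * r%:R).
have eta0 : 0 < eta by rewrite divr_gt0 // mulr_gt0.
have [d1 d10 Hlow] := few_low_degree a32 a2 r0 eps0 eps1 eta0.
pose F : R := 4 * (r.+1%:R * r.+1`!%:R).
have F0 : 0 < F by rewrite !mulr_gt0 // ltr0n // fact_gt0.
pose d2 := rho * d0 / F.
have d20 : 0 < d2 by rewrite divr_gt0 // mulr_gt0.
pose delta := Num.min d0 (Num.min d1 d2).
have delta0 : 0 < delta by rewrite !lt_min d00 d10.
have [le_d0 le_d1 le_d2] : [/\ delta <= d0, delta <= d1 & delta <= d2].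
  by rewrite /delta !ge_min !lexx !orbT.
have [n1 Hfew] := @blowup_free_tnum R r t delta delta0.
(* Half of [d0] gives the strict inequality that [many_bidir_cliques] requires. *)
pose gam := Num.min (kap / 4) (Num.min d1 (d0 / 2)).
have gam0 : 0 < gam by rewrite !lt_min d10 !divr_gt0.
have [gam_kap gam_d1 gam_d0] : [/\ gam <= kap / 4, gam <= d1 & gam <= d0 / 2].
  by rewrite /gam !ge_min !lexx !orbT.
(* Passing from [e_a] to the degree sum doubles [gamma], and the last third of [gam] absorbs the
   error [a r ^ 3] from [turan_num_ge]. *)
exists (gam / 3); split; first by rewrite divr_gt0.
have gam3 : 0 < gam / 3 by rewrite divr_gt0.
have [n2 Hn2] := eventually_sqr_ge (2 * r%:R ^+ 3) gam3.
have beta2 : 0 < beta / 2 by rewrite divr_gt0.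
have [n3 Hn3] := eventually_sqr_ge (2 * r%:R) beta2.
exists (maxn n1 (maxn n2 n3)) => n; rewrite !geq_max => /and3P[nn1 nn2 nn3] G loopG freeG eG.
have [n_gt0 big2] := Hn2 n nn2; have [_ big3] := Hn3 n nn3.
have irr v : G v v = false by apply: negbTE.
have cardn : #|'I_n| = n := card_ord n.
have n1R : 1 <= n%:R :> R by rewrite ler1n.
have fewT := Hfew n nn1 G loopG freeG.
have fewT' d : delta <= d -> (tnum G r.+1)%:R <= d * n%:R ^+ r.+1.
  by move=> /(ler_wpM2r (exprn_ge0 r.+1 (ler0n R n))); apply: le_trans.
have many : (a * (1 - r%:R^-1) - gam) * n%:R ^+ 2 <= \sum_u deg a G u.
  have a0 : 0 <= a by lra.
  have r30 : 0 <= r%:R ^+ 3 :> R by rewrite exprn_ge0.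
  have := ler_wpM2l a0 (turan_num_ge R n r0).
  have := ler_wpM2r r30 a2; have := ler_wpM2l r30 n1R.
  rewrite sum_deg_e_a //; move: eG big2.
  move: (n%:R ^+ 2 : R) ((turan_num r n)%:R : R) (e_a a G) (r%:R ^+ 3 : R) (r%:R^-1 : R) (n%:R : R).
  by clear => N T E r3 ir m; lra.
have manyd d : gam <= d -> (a * (1 - r%:R^-1) - d) * n%:R ^+ 2 <= \sum_u deg a G u.
  move=> le; apply: le_trans many; apply: ler_wpM2r; first exact: sqr_ge0.
  lra.
have manyK : d0 * n%:R ^+ r < (tnum (bidir G) r)%:R.
  have := Hmany 'I_n G; rewrite cardn; apply=> //; first exact: fewT'.
  apply: lt_le_trans many; rewrite ltr_pM2r ?exprn_gt0 ?ltr0n //; lra.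
have := Hlow 'I_n G; rewrite cardn => /(_ n_gt0 irr (fewT' _ le_d1) (manyd _ gam_d1)).
set S := [set v | _] => fewS.
have [||||||K [clK avoid few]] := @select_clique R 'I_n G r S d0 rho; rewrite ?cardn //.
- have := ler_wpM2l (ltW rR) fewS.
  by have -> : r%:R * (eta * n%:R) = d0 / 2 * n%:R by rewrite /eta; field.
- apply: (le_trans (ler_wpM2l (ltW F0) (fewT' _ le_d2))).
  by have -> // : F * (d2 * n%:R ^+ r.+1) = rho * d0 * n%:R ^+ r.+1;
    rewrite /d2; field; rewrite lt0r_neq0.
have degK i : (a * (1 - r%:R^-1) - eps) * #|'I_n|%:R <= deg a G (tnth K i).
  by have := avoid i; rewrite inE -leNgt cardn.
have := clique_partition a32 a2 r0 (ltW eps0) (ltW rho0) (ltW gam0) degK few.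
rewrite cardn => /(_ many).
set p := class_of _ _ _; set kap' := gam + _ + _ => -[close var].
have kap'_le : kap' <= kap by rewrite /kap' /rho; move: eps_kap; lra.
have N0 : 0 <= n%:R ^+ 2 :> R := sqr_ge0 _.
have [s sD] := perm_matching p (@residue r n r0).
exists s.
have var' : pvar R p <= xi ^+ 2 * n%:R ^+ 2.
  by apply: le_trans var _; apply: ler_wpM2r => //; lra.
have mis := misfit_le r0 (ltW xi0) var'.
have D_le : #|[set v | residue r0 (s v) != p v]|%:R <= r%:R * (xi * n%:R + 1) :> R.
  by apply: le_trans mis; rewrite ler_nat.
have := arc_dist_le r0 G p s; rewrite -(ler_nat R) natrD !natrM => /le_trans; apply.
have := ler_wpM2r (ler0n R n) D_le.
have -> : r%:R * (xi * n%:R + 1) * n%:R = beta / 8 * n%:R ^+ 2 + r%:R * n%:R.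
  by rewrite /xi; field.
have := ler_wpM2r N0 kap'_le; have := ler_wpM2r N0 kap_beta.
move: close big3.
move: ((inner G p + missing G p)%:R : R) (#|_|%:R : R) (n%:R ^+ 2 : R) (n%:R : R) (r%:R : R).
move: (kap) (kap'); clear => k k' I D N m q; lra.
Qed.
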